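(* Let $0<\alpha<1$ and $r\ge1$. There is a constant $c_{\alpha,r}>0$, depending only on $\alpha$ and $r$, such that the following holds. Let $T>0$, $M\ge1$ an integer, and suppose that $\varepsilon\le c_{\alpha,r}T^{-\alpha}M^{-\alpha}$ and $$\frac{(2-\alpha)2^{1-\alpha}-1}{\Gamma(3-\alpha)}\left(\frac{rT}{M}\right)^{1-\alpha}\le1 .$$ Put $$\rho_1=\frac{2}{\max_{1\le n\le M}\tau_n},\qquad \rho=\max\{\mu-C_P^{-2},0\},$$ where $C_P$ is the Poincaré constant of $\Omega$, and suppose that $0\le\rho<\rho_1$. Then, for $1\le n\le M$, the solution $\{v^n\}$ of the semidiscrete scheme $$\nabla_\tau v^n+\bar\partial_{\tau,\varepsilon}^\alpha v^n=\Delta v^{n-\frac12}+\mu v^{n-\frac12}+\bar f^{\,n-\frac12},\qquad 1\le n\le M,$$ (with homogeneous Dirichlet boundary condition) satisfies $$\|v^n\|\le\begin{cases}e^{\frac{\rho\rho_1t_n}{\rho_1-\rho}}\Big(\|v^0\|+\dfrac{\rho_1}{\rho_1-\rho}\displaystyle\sum_{j=1}^n\tau_j\|\bar f^{\,j-\frac12}\|\Big),&0<\rho<\rho_1,\\[4mm]\|v^0\|+\displaystyle\sum_{j=1}^n\tau_j\|\bar f^{\,j-\frac12}\|,&\rho=0.\end{cases}$$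
   Context: Setting: $\Omega\subset\mathbb R^d$ ($d=1,2$) is a domain with Poincaré constant $C_P$, i.e. $\|w\|\le C_P\|\nabla w\|$ for all $w\in H_0^1(\Omega)$; $\|\cdot\|$ is the $L^2(\Omega)$ norm; $\lambda>0$ and $\mu=\lambda-\frac d4$. A source $\widetilde f$ on $\Omega\times(0,T]$ is given and $\bar f^{\,n-\frac12}=\frac1{\tau_n}\int_{t_{n-1}}^{t_n}\widetilde f(\cdot,t)\,dt$. The functions $v^n$ vanish on $\partial\Omega$ and $v^0=\widetilde\phi$ is a given initial value. The scheme is understood weakly, tested against functions in $H_0^1(\Omega)$. Graded mesh: $t_n=T(n/M)^r$, $0\le n\le M$, $\tau_n=t_n-t_{n-1}$; $\nabla_\tau v^n=(v^n-v^{n-1})/\tau_n$; $v^{n-\frac12}=\frac12(v^n+v^{n-1})$. SOE approximation: for a prescribed tolerance $\varepsilon>0$ there are given $N_{\exp}\in\mathbb N$, $\varpi_\ell>0$, $s_\ell>0$ with $\big|\sum_{\ell=1}^{N_{\exp}}\varpi_\ell e^{-s_\ell x}-x^{-\alpha}\big|\le\varepsilon$ for all $x\in[\tau_1,T]$. Fast averaged L1 operator: $\bar\partial_{\tau,\varepsilon}^\alpha v^n=\sum_{k=1}^n\widetilde a_{n,k}\nabla_\tau v^k$, where $$\widetilde a_{n,k}=\frac{1}{\tau_n\Gamma(1-\alpha)}\int_{t_{n-1}}^{t_n}\int_{t_{k-1}}^{t_k}\sum_{\ell=1}^{N_{\exp}}\varpi_\ell e^{-s_\ell(t-s)}\,ds\,dt\quad(1\le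 k\le n-2),$$ $$\widetilde a_{n,k}=\frac{1}{\tau_n\Gamma(1-\alpha)}\int_{t_{n-1}}^{t_n}\int_{t_{k-1}}^{\min\{t,t_k\}}(t-s)^{-\alpha}\,ds\,dt\quad(k\in\{n-1,n\},\ k\ge1).$$ *)

(* Defs.v *)
From HB Require Import structures.
From mathcomp Require Import all_boot all_order all_algebra.
From mathcomp Require Import all_classical all_reals all_analysis.

Set Implicit Arguments.
Unset Strict Implicit.
Unset Printing Implicit Defensive.
Import Order.TTheory GRing.Theory Num.Theory.
Import numFieldNormedType.Exports.

Local Open Scope classical_set_scope.
Local Open Scope ring_scope.

(* The sigma-algebra of R^n is generated by the coordinate functions, as the
   library does for n.-tuple; it is the Borel sigma-algebra of R^n. *)
Definition rv_display : measure_display.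
Proof. exact. Qed.

Section measurable_rv.
Context {R : realType} {n : nat}.

Let coord_rv : 'I_n -> 'rV[R]_n -> R := fun i x => x ord0 i.

Let rv_set0 : g_sigma_preimage coord_rv set0.
Proof. exact: sigma_algebra0. Qed.

Let rv_setC A : g_sigma_preimage coord_rv A -> g_sigma_preimage coord_rv (~` A).
Proof. exact: sigma_algebraC. Qed.

Let rv_bigcup (F : (set 'rV[R]_n)^nat) :
  (forall i, g_sigma_preimage coord_rv (F i)) ->
  g_sigma_preimage coord_rv (\bigcup_i (F i)).
Proof. exact: sigma_algebra_bigcup. Qed.

HB.instance Definition _ := @isMeasurable.Build rv_display
  'rV[R]_n (g_sigma_preimage coord_rv) rv_set0 rv_setC rv_bigcup.

End measurable_rv.

Lemma measurable_fun_rv d (T : measurableType d) (R : realType) (n : nat)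
    (f : T -> 'rV[R]_n) :
  (forall i, measurable_fun [set: T] (fun t => f t ord0 i)) ->
  measurable_fun [set: T] f.
Proof.
move=> mf _ A mA; rewrite setTI.
suff H : g_sigma_preimage (fun i t => f t ord0 i) `<=` @measurable _ T.
  apply: H; rewrite (g_sigma_preimage_comp (fun i (x : 'rV[R]_n) => x ord0 i) f).
  by exists A => //; rewrite setTI.
apply: smallest_sub; first exact: sigma_algebra_measurable.
case: n => [|n] in f mf A mA *; first by rewrite big_ord0.
by rewrite -bigcup_mkord_ord; apply: bigcup_sub => i _ B [C mC <-]; exact: mf.
Qed.

Definition rv_rcons (R : realType) (n : nat) (p : 'rV[R]_n * R) : 'rV[R]_n.+1 :=
  \row_i (if unlift ord_max i is Some j then p.1 ord0 j else p.2).

Lemma measurable_rv_rcons (R : realType) (n : nat) :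
  measurable_fun [set: 'rV[R]_n * R] (@rv_rcons R n).
Proof.
apply: measurable_fun_rv => i.
under eq_fun do rewrite mxE.
case: unliftP => [j _|_]; last exact: measurable_snd.
apply: (@measurableT_comp _ _ _ _ _ _ (fun x : 'rV[R]_n => x ord0 j)) => //.
move=> _ Y mY; rewrite setTI; apply: sub_sigma_algebra => /=.
rewrite -bigcup_seq/=; exists j => /=; first by rewrite mem_index_enum.
by exists Y => //; rewrite setTI.
Qed.

Section lebesgue_rcons.
Local Open Scope ereal_scope.
Context {R : realType} {n : nat}.
Variable mu : {measure set 'rV[R]_n -> \bar R}.

Definition lebesgue_rcons : set 'rV[R]_n.+1 -> \bar R :=
  pushforward (mu \x lebesgue_measure) (@rv_rcons R n).

HB.instance Definition _ := Measure.copy lebesgue_rcons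
  (measure_function_pushforward__canonical__measure_function_Measure
     (mu \x lebesgue_measure) (@measurable_rv_rcons R n)).

End lebesgue_rcons.

Fixpoint lebesgue_rv (R : realType) (n : nat) :
    {measure set 'rV[R]_n -> \bar R} :=
  match n with
  | 0 => \d_(0 : 'rV[R]_0)
  | m.+1 => lebesgue_rcons (lebesgue_rv R m)
  end.

Section sobolev.
Context {R : realType} {d : nat}.
Variable Omega : set 'rV[R]_d.
Implicit Types (u w phi : 'rV[R]_d -> R) (g h : 'I_d -> 'rV[R]_d -> R).

Local Notation leb := (lebesgue_rv R d).

(* Functions are defined on all of R^d; only their values on Omega matter. *)
Definition L2 u : Prop := (u \_ Omega) \in Lfun leb 2%:E.

(* The extended-valued norm is used for convergence, so that a function outside
   L^2 is not given a finite norm by fine. *)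
Definition L2enorm u : \bar R := 'N[leb]_2%:E[EFin \o (u \_ Omega)]%E.

Definition L2norm u : R := fine (L2enorm u).

Definition L2inner u w : R := \int[leb]_(x in Omega) (u x * w x).

Definition L2vnorm g : R := Num.sqrt (\sum_(i < d) L2norm (g i) ^+ 2).

Definition L2vinner g h : R := \sum_(i < d) L2inner (g i) (h i).

Definition partial (i : 'I_d) u : 'rV[R]_d -> R :=
  fun x => 'D_(delta_mx ord0 i) u x.

Definition smooth u : Prop :=
  forall s : seq 'I_d,
    continuous (foldr partial u s) /\
    forall (i : 'I_d) x, derivable (foldr partial u s) x (delta_mx ord0 i).

Definition test_function phi : Prop :=
  smooth phi /\
  exists2 K : set 'rV[R]_d, compact K /\ K `<=` Omega &
    forall x, ~ K x -> phi x = 0.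

(* Weak gradients are unique up to null sets, so quantifying over all weak
   gradients of a function is the same as fixing one of them. *)
Definition weak_gradient u g : Prop :=
  (forall i, L2 (g i)) /\
  forall phi i, test_function phi ->
    L2inner u (partial i phi) = - L2inner (g i) phi.

(* H_0^1(Omega) is the closure of the test functions in H^1(Omega). *)
Definition H01 u : Prop :=
  L2 u /\
  exists2 g, weak_gradient u g &
    exists phi_ : nat -> 'rV[R]_d -> R,
      [/\ forall k, test_function (phi_ k),
          L2enorm (phi_ k \- u) @[k --> \oo] --> 0%E &
          forall i, L2enorm (partial i (phi_ k) \- g i) @[k --> \oo] --> 0%E].

Definition poincare (CP : R) : Prop :=
  0 < CP /\
  forall w g, H01 w -> weak_gradient w g -> L2norm w <= CP * L2vnorm g.

End sobolev.

Definition is_domain (R : realType) (d : nat) (Omega : set 'rV[R]_d) : Prop :=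
  [/\ open Omega, connected Omega & Omega !=set0].

Definition Gamma (R : realType) (x : R) : R :=
  \int[lebesgue_measure]_(t in `]0, +oo[) (t `^ (x - 1) * expR (- t)).

Section scheme.
Context {R : realType}.
Variables (alpha r T : R) (M : nat).

Definition tmesh (n : nat) : R := T * (n%:R / M%:R) `^ r.

Definition tau (n : nat) : R := tmesh n - tmesh n.-1.

Definition tau_max : R := \big[Num.max/0]_(1 <= n < M.+1) tau n.

Section soe.
Variables (Nexp : nat) (varpi s : 'I_Nexp -> R).

Definition soe (x : R) : R := \sum_(l < Nexp) varpi l * expR (- s l * x).

Definition soe_approx (eps : R) : Prop :=
  (forall l, 0 < varpi l /\ 0 < s l) /\
  forall x, tau 1 <= x <= T -> `|soe x - x `^ (- alpha)| <= eps.

(* On the diagonal the inner integrand is singular at y = t only, where powR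
   takes the value 0; this does not affect the integral. *)
Definition fast_coef (n k : nat) : R :=
  (tau n * Gamma (1 - alpha))^-1 *
  if (k.+2 <= n)%N then
    \int[lebesgue_measure]_(t in `[tmesh n.-1, tmesh n])
      \int[lebesgue_measure]_(y in `[tmesh k.-1, tmesh k]) soe (t - y)
  else
    \int[lebesgue_measure]_(t in `[tmesh n.-1, tmesh n])
      \int[lebesgue_measure]_(y in `[tmesh k.-1, Num.min t (tmesh k)])
        (t - y) `^ (- alpha).

Section grid_functions.
Variable X : Type.
Implicit Types v : nat -> X -> R.

Definition diff_quot v (n : nat) : X -> R :=
  fun x => (v n x - v n.-1 x) / tau n.

Definition midpoint v (n : nat) : X -> R := fun x => (v n x + v n.-1 x) / 2.

Definition fast_L1 v (n : nat) : X -> R :=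
  fun x => \sum_(1 <= k < n.+1) fast_coef n k * diff_quot v k x.

Definition time_avg (f : X -> R -> R) (n : nat) : X -> R :=
  fun x => (tau n)^-1 *
    \int[lebesgue_measure]_(t in `[tmesh n.-1, tmesh n]) f x t.

End grid_functions.

(* Integrability in time makes the averages meaningful; their square
   integrability makes the right-hand side of the weak formulation and of the
   stability bound meaningful. *)
Definition admissible_source (d : nat) (Omega : set 'rV[R]_d)
    (f : 'rV[R]_d -> R -> R) : Prop :=
  {ae lebesgue_rv R d, forall x, Omega x ->
    lebesgue_measure.-integrable `]0, T] (EFin \o f x)} /\
  forall n, (1 <= n <= M)%N -> L2 Omega (time_avg f n).

Definition weak_solution (d : nat) (Omega : set 'rV[R]_d) (mu : R)
    (f : 'rV[R]_d -> R -> R) (phi : 'rV[R]_d -> R)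
    (v : nat -> 'rV[R]_d -> R) : Prop :=
  [/\ v 0%N = phi,
      forall n, (n <= M)%N -> H01 Omega (v n) &
      forall n, (1 <= n <= M)%N ->
      forall w gw gv, H01 Omega w -> weak_gradient Omega w gw ->
        weak_gradient Omega (midpoint v n) gv ->
        L2inner Omega (diff_quot v n \+ fast_L1 v n) w =
        - L2vinner Omega gv gw + mu * L2inner Omega (midpoint v n) w +
        L2inner Omega (time_avg f n) w].

End soe.
End scheme.

(* Main.v *)
Require Import Defs.
From HB Require Import structures.
From mathcomp Require Import all_boot all_order all_algebra.
From mathcomp Require Import all_classical all_reals all_analysis.
From mathcomp Require Import measurable_realfun complex ring lra.

Set Implicit Arguments.
Unset Strict Implicit.
Unset Printing Implicit Defensive.
Import Order.TTheory GRing.Theory Num.Theory.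
Import numFieldNormedType.Exports.

Local Open Scope classical_set_scope.
Local Open Scope ring_scope.

(** Idea. On the finite-dimensional space spanned by the functions v^0, ..., v^M
the L^2 inner product and the Dirichlet form can be diagonalized simultaneously,
the source entering only through its projection. Testing the scheme with an
eigenvector decouples it into scalar recursions. For a single mode with
eigenvalue lam >= -rho the Crank-Nicolson average gives
  (B + lam/2) x_n = (B - b - lam/2) x_{n-1} + (history) + phi,
where the history is bounded by b max |x_k| because the kernel is monotone.
Whatever the sign of B - b - lam/2, the inequality b <= B yields
  |x_n| <= ((1 + rho tau/2) max_{k<n} |x_k| + tau |phi|) / (1 - rho tau/2),
and Minkowski's inequality over the modes followed by a Gronwall argument gives
the bound. Estimating in L^2 before decoupling would lose: the coefficient of
x_{n-1} and that of the history are extremal for different modes.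

The kernel is monotone up to the last history cell because the gap of the exact
kernel between the last two cells dominates the tolerance eps; b <= B is the
condition on (rT/M)^(1-alpha), once Gamma(3-alpha) is compared with
(2-alpha)(1-alpha) Gamma(1-alpha). *)

(** * Symmetric matrices *)

(** The domain is only assumed to satisfy a Poincaré inequality, so [H01] need not embed compactly
    in L^2 and an eigenbasis of the Laplacian may not exist. The span of the computed solution
    replaces it: its modes lie in [H01], hence are legitimate test functions, and they serve all
    time steps at once. The functions v^k may be linearly dependent, or have differences that are
    null in L^2, so both Gram matrices may be singular. The pencil is therefore written with the
    eigenvalue [th] on the side of the L^2 form: the Poincaré inequality becomes [th <= CP^2], that
    is [th^-1 - mu >= CP^-2 - mu >= -rho], and degenerate directions appear as [th = 0]. The source
    is not in the span; Bessel's inequality bounds the coordinates of its projection. Monotonicity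
    of the weights is delicate at one place only, where the exponential sum hands over to the exact
    kernel. There the tolerance must be paid for by a strict decrease of the power kernel across
    half a cell, and the grading bounds that decrease from below. *)

Lemma mulmx_tr_ge0 (R : realDomainType) (n : nat) (u : 'rV[R]_n) :
  0 <= (u *m u^T) 0 0.
Proof. by rewrite mxE sumr_ge0// => i _; rewrite mxE -expr2 sqr_ge0. Qed.

Lemma mulmx_tr_eq0 (R : realDomainType) (n : nat) (u : 'rV[R]_n) :
  ((u *m u^T) 0 0 == 0) = (u == 0).
Proof.
apply/eqP/eqP => [|->]; last by rewrite mul0mx mxE.
rewrite mxE => /eqP; rewrite psumr_eq0 => [/allP u0|i _]; last first.
  by rewrite mxE -expr2 sqr_ge0.
apply/rowP => j; have := u0 j (mem_index_enum j).
by rewrite !mxE mulf_eq0 orbb => /eqP.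
Qed.

(** Drawn from the Hermitian spectral theorem over [R[i]]: the spectral values are real, and since
    the characteristic polynomial commutes with the embedding, such a value is already an eigenvalue
    over [R], with a real eigenvector to normalize. *)
Lemma symmetric_eigenvector (R : rcfType) (n : nat) (A : 'M[R]_n.+1) :
  A^T = A -> exists (a : R) (u : 'rV[R]_n.+1), u *m A = a *: u /\ u *m u^T = 1%:M.
Proof.
move=> symA; pose B := map_mx (real_complex R) A.
have hermB : B \is hermsymmx.
  apply: realsym_hermsym.
    by apply/is_hermitianmxP; rewrite expr0 scale1r map_mx_id// map_trmx symA.
  by apply/mxOverP => i j; rewrite mxE; apply/complex_realP; exists (A i j).
have [a aE] : exists a, spectral_diag B 0 0 = real_complex R a.
  apply/complex_realP; have /mxOverP := hermitian_spectral_diag_real hermB.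
  exact.
have eigB : eigenvalue B (real_complex R a).
  apply/eigenvalueP; exists (row 0 (spectralmx B)).
    have /orthomx_spectralP BE := hermitian_normalmx hermB.
    rewrite {2}BE -row_mul !mulmxA mulmxV ?spectral_unit// mul1mx.
    by rewrite -aE mul_diag_mx; apply/rowP => j; rewrite !mxE.
  apply/eqP => /(congr1 (mulmx^~ (invmx (spectralmx B)))).
  rewrite -row_mul mulmxV ?spectral_unit// mul0mx => /rowP/(_ 0).
  by rewrite !mxE => /eqP; rewrite oner_eq0.
have : eigenvalue A a.
  move: eigB; rewrite !eigenvalue_root_char /B -map_char_poly.
  by rewrite fmorph_root.
case/eigenvalueP => w wA w0.
have ww0 : 0 < (w *m w^T) 0 0.
  by rewrite lt_def mulmx_tr_eq0 w0 mulmx_tr_ge0.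
have ww : w *m w^T = ((w *m w^T) 0 0)%:M by rewrite -mx11_scalar.
move: ww0 ww; set c := (w *m w^T) 0 0 => c0 ww.
exists a, ((Num.sqrt c)^-1 *: w); split.
  by rewrite -scalemxAl wA !scalerA mulrC.
rewrite linearZ/= -scalemxAl -scalemxAr scalerA ww scale_scalar_mx -expr2.
by rewrite exprVn sqr_sqrtr ?(ltW c0)// mulVf// gt_eqF.
Qed.

(* The Householder reflection exchanging [u] and the first basis vector. *)
Lemma orthogonal_completion (R : rcfType) (n : nat) (u : 'rV[R]_n.+1) :
  u *m u^T = 1%:M -> exists (Q : 'M[R]_n.+1), Q *m Q^T = 1%:M /\ row 0 Q = u.
Proof.
move=> uu; pose e : 'rV[R]_n.+1 := delta_mx 0 0.
have eeT : e *m e^T = 1%:M.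
  by rewrite trmx_delta mul_delta_mx; apply/matrixP => i j; rewrite !ord1 !mxE.
have [ue|/eqP ue] := eqVneq u e.
  by exists 1%:M; rewrite trmx1 mulmx1 ue; split=> //; rewrite row1.
pose w := u - e; pose a := (w *m w^T) 0 0.
have ww : w *m w^T = a%:M by rewrite [LHS]mx11_scalar.
have [t utE] : exists t, u *m e^T = t%:M by exists ((u *m e^T) 0 0); rewrite -mx11_scalar.
have etE : e *m u^T = t%:M by rewrite -[LHS]trmxK trmx_mul trmxK utE tr_scalar_mx.
have aE : a = 2 * (1 - t).
  rewrite /a linearB/= mulmxBl !mulmxBr uu eeT utE etE !mxE/=; ring.
have a0 : a != 0.
  by rewrite /a mulmx_tr_eq0 subr_eq0; apply/eqP.
pose Q := 1%:M - (2 / a) *: (w^T *m w).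
have QT : Q^T = Q by rewrite linearB/= linearZ/= trmx_mul trmxK trmx1.
exists Q; split.
  rewrite QT /Q mulmxBr mulmx1 mulmxBl mul1mx -scalemxAr -scalemxAl mulmxA.
  rewrite -(mulmxA w^T) ww mul_mx_scalar -scalemxAl !scalerA.
  have -> : 2 / a * (2 / a) * a = 2 / a + 2 / a by field.
  rewrite scalerDl; apply/matrixP => i j; rewrite !mxE; ring.
rewrite rowE -/e mulmxBr mulmx1 -scalemxAr mulmxA.
have -> : e *m w^T = (t - 1)%:M.
  by rewrite linearB/= mulmxBr etE eeT -raddfB.
rewrite mul_scalar_mx scalerA.
have -> : 2 / a * (t - 1) = -1.
  rewrite aE; field; move: a0; rewrite aE mulf_eq0 negb_or => /andP[_].
  by rewrite subr_eq0 eq_sym -subr_eq0.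
by rewrite scaleN1r opprK /w addrC subrK.
Qed.

(** Deflation: in an orthonormal basis starting with a unit eigenvector the first row is a multiple
    of the first basis vector; by symmetry so is the first column, and induction handles the
    remaining block. *)
Theorem symmetric_diagonalization (R : rcfType) (n : nat) (A : 'M[R]_n) :
  A^T = A -> exists (P : 'M[R]_n) (d : 'rV[R]_n),
    P *m P^T = 1%:M /\ P *m A *m P^T = diag_mx d.
Proof.
elim: n A => [|n IHn] A symA.
  by exists 1%:M, 0; split; apply/matrixP => -[].
have [a [u [uA /orthogonal_completion[Q [QQ rQ]]]]] := symmetric_eigenvector symA.
pose N : 'M[R]_(1 + n) := Q *m A *m Q^T.
have symN : N^T = N by rewrite /N !trmx_mul trmxK symA mulmxA.
have rowN : row 0 N = a *: delta_mx 0 0.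
  rewrite /N -mulmxA row_mul rQ mulmxA uA -scalemxAl -rQ -row_mul QQ.
  by rewrite row1.
have urN : ursubmx N = 0.
  apply/matrixP => i j; rewrite !mxE ord1.
  have /rowP/(_ (rshift 1 j)) := rowN; rewrite !mxE eqxx/=.
  rewrite (_ : lshift n 0 = 0); last exact: val_inj.
  by move=> ->; rewrite mulr0.
have dlN : dlsubmx N = 0 by rewrite -[N]symN -trmx_ursub urN trmx0.
have [|P [d [PP PNP]]] := IHn (drsubmx N).
  by rewrite trmx_drsub symN.
pose P1 : 'M[R]_(1 + n) := block_mx 1%:M 0 0 P.
have P1P1 : P1 *m P1^T = 1%:M.
  rewrite /P1 tr_block_mx mulmx_block !trmx0 !(mulmx0, mul0mx, addr0, add0r).
  by rewrite PP trmx1 mulmx1 -scalar_mx_block.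
have P1N : P1 *m N *m P1^T = diag_mx (row_mx (ulsubmx N) d).
  rewrite -[N in LHS]submxK urN dlN /P1 tr_block_mx !mulmx_block !trmx0.
  rewrite !(mulmx0, mul0mx, addr0, add0r) PNP trmx1 mulmx1 mul1mx diag_mx_row.
  by congr block_mx; apply/matrixP => i j; rewrite !ord1 !mxE.
exists (P1 *m Q : 'M[R]_(1 + n)), (row_mx (ulsubmx N) d); split.
  by rewrite trmx_mul mulmxA -(mulmxA P1) QQ mulmx1 P1P1.
by rewrite trmx_mul -P1N /N !mulmxA.
Qed.

(** With [y = u G], the form at [u + t y] equals [2 t |y|^2 + t^2 b]; it can stay nonnegative for
    small negative [t] only if [y] vanishes. *)
Lemma psd_isotropic (R : realFieldType) (n : nat) (G : 'M[R]_n) (u : 'rV[R]_n) :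
  G^T = G -> (forall w : 'rV[R]_n, 0 <= (w *m G *m w^T) 0 0) ->
  (u *m G *m u^T) 0 0 = 0 -> u *m G = 0.
Proof.
move=> symG posG u0; pose y := u *m G.
pose a := (y *m y^T) 0 0; pose b := (y *m G *m y^T) 0 0.
have b0 : 0 <= b by exact: posG.
have yE : y^T = G *m u^T by rewrite trmx_mul symG.
have key t : 0 <= t * a *+ 2 + t ^+ 2 * b.
  suff -> : t * a *+ 2 + t ^+ 2 * b =
      ((u + t *: y) *m G *m (u + t *: y)^T) 0 0 by exact: posG.
  have uGu : u *m G *m u^T = 0%:M by rewrite [LHS]mx11_scalar u0.
  have uGy : u *m G *m y^T = a%:M by rewrite -mx11_scalar.
  have yGu : y *m G *m u^T = a%:M by rewrite -mulmxA -yE -mx11_scalar.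
  have yGy : y *m G *m y^T = b%:M by rewrite -mx11_scalar.
  rewrite linearD/= linearZ/= !mulmxDl !mulmxDr -!scalemxAl -!scalemxAr.
  by rewrite uGu uGy yGu yGy !mxE/=; ring.
apply/eqP; rewrite -mulmx_tr_eq0; apply/eqP.
apply/eqP; rewrite -[_ == 0]negbK; apply/negP => a0.
have := key (- a / (b + 1)).
rewrite (_ : _ + _ = - (a ^+ 2 * (b + 2) / (b + 1) ^+ 2)); last first.
  by field; rewrite gt_eqF// ltr_wpDl.
rewrite oppr_ge0 leNgt => /negP; apply.
by rewrite divr_gt0 ?mulr_gt0 ?exprn_gt0 ?ltr_wpDl// lt_def a0 mulmx_tr_ge0.
Qed.

(** [S] may be singular, so [E] need not be invertible and the conclusions are factorizations
    instead of a change of basis. [W] whitens [S] on its range, [G <= C S] makes [G] vanish on the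
    kernel of [S], and diagonalizing [W G W^T] loses nothing. *)
Theorem simultaneous_diagonalization (R : rcfType) (n : nat) (G S : 'M[R]_n)
    (C : R) :
  G^T = G -> S^T = S -> 0 < C ->
  (forall u : 'rV[R]_n, 0 <= (u *m G *m u^T) 0 0) ->
  (forall u : 'rV[R]_n, (u *m G *m u^T) 0 0 <= C * (u *m S *m u^T) 0 0) ->
  exists (E : 'M[R]_n) (th : 'rV[R]_n),
    [/\ E *m G *m E^T = diag_mx th, (forall i, 0 <= th 0 i <= C),
        G *m E^T = S *m E^T *m diag_mx th &
        G = S *m E^T *m diag_mx th *m (E *m S)].
Proof.
move=> symG symS C0 posG GS.
have posS (u : 'rV[R]_n) : 0 <= (u *m S *m u^T) 0 0.
  by rewrite -(pmulr_rge0 _ C0) (le_trans (posG u) (GS u)).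
have diagE (A B : 'M[R]_n) i :
    (A *m B *m A^T) i i = (row i A *m B *m (row i A)^T) 0 0.
  by rewrite tr_row colE mulmxA -row_mul -row_mul -colE !mxE.
have [Q [sg [QQ QSQ]]] := symmetric_diagonalization symS.
have QtQ : Q^T *m Q = 1%:M by apply: mulmx1C.
have sg0 i : 0 <= sg 0 i.
  have := posS (row i Q); rewrite -diagE QSQ mxE eqxx mulr1n.
  by [].
have SE : S = Q^T *m diag_mx sg *m Q.
  by rewrite -QSQ !mulmxA QtQ mul1mx -mulmxA QtQ mulmx1.
(* As the inverse of 0 is 0, [W^T W] will be a pseudo-inverse of [S], and [J] marks its nonzero
   eigenvalues. *)
pose w : 'rV[R]_n := \row_i (Num.sqrt (sg 0 i))^-1.
pose J : 'rV[R]_n := \row_i (sg 0 i != 0)%:R.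
have wJ i : w 0 i ^+ 2 * sg 0 i = J 0 i.
  rewrite !mxE exprVn sqr_sqrtr//; have [->|s0] := eqVneq (sg 0 i) 0.
    by rewrite mulr0.
  by rewrite mulVf.
pose W := diag_mx w *m Q.
have WT : W^T = Q^T *m diag_mx w by rewrite trmx_mul tr_diag_mx.
have WSW : W *m S *m W^T = diag_mx J.
  rewrite SE WT /W !mulmxA -(mulmxA (diag_mx w) Q) QQ mulmx1.
  rewrite -(mulmxA _ Q) QQ mulmx1 !mulmx_diag; congr diag_mx.
  by apply/rowP => i; rewrite [LHS]mxE mxE -wJ expr2 mulrAC.
have SWWS : S *m W^T *m W *m S = S.
  rewrite {1 2}SE WT /W !mulmxA -(mulmxA _ Q) QQ mulmx1.
  rewrite -(mulmxA _ Q) QQ mulmx1 -!(mulmxA Q^T) !mulmx_diag [in RHS]SE.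
  rewrite -[RHS]mulmxA; congr mulmx; congr mulmx; congr diag_mx.
  apply/rowP => i; have := wJ i; rewrite !mxE.
  have [->|s0] := eqVneq (sg 0 i) 0; first by move=> _; rewrite !mul0r.
  move=> /= J1; transitivity (sg 0 i * ((Num.sqrt (sg 0 i))^-1 ^+ 2 * sg 0 i)).
    by rewrite expr2; ring.
  by rewrite J1 mulr1.
clearbody W; clear WT.
(* The rows of [1 - S W^T W] annihilate [S], hence are isotropic for [G] because [G <= C S], hence
   annihilate [G]. *)
have GE : G = S *m W^T *m W *m G.
  apply/eqP; rewrite -subr_eq0 -{1}[G]mul1mx -mulmxBl.
  apply/eqP/row_matrixP => i; rewrite row_mul row0.
  apply: psd_isotropic => //; apply/eqP; rewrite eq_le posG andbT.
  rewrite (le_trans (GS _))// -row_mul mulmxBl mul1mx SWWS subrr row0.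
  by rewrite mul0mx mxE mulr0.
have [P [th [PP PHP]]] : exists (P : 'M[R]_n) (d : 'rV[R]_n),
    P *m P^T = 1%:M /\ P *m (W *m G *m W^T) *m P^T = diag_mx d.
  by apply: symmetric_diagonalization; rewrite !trmx_mul trmxK symG mulmxA.
have PtP : P^T *m P = 1%:M by apply: mulmx1C.
have HE : W *m G *m W^T = P^T *m diag_mx th *m P.
  by rewrite -PHP !mulmxA PtP mul1mx -!mulmxA PtP mulmx1.
exists (P *m W), th; split.
- by rewrite trmx_mul -PHP !mulmxA.
- move=> i; have thE : th 0 i = ((P *m W) *m G *m (P *m W)^T) i i.
    transitivity ((P *m (W *m G *m W^T) *m P^T) i i).
      by rewrite PHP mxE eqxx.
    by rewrite trmx_mul !mulmxA.
  rewrite {1}thE diagE posG/= thE diagE (le_trans (GS _))// -diagE.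
  (* [E S E^T] is [P J P^T]; as [J] has entries 0 and 1, its diagonal is at most that of
     [P P^T = 1]. *)
  rewrite ger_pMr// (_ : _ *m _ *m _ = P *m diag_mx J *m P^T); last first.
    by rewrite -WSW trmx_mul !mulmxA.
  have <- : (P *m P^T) i i = 1 by rewrite PP mxE eqxx.
  rewrite mxE [leRHS]mxE ler_sum// => j _; rewrite mul_mx_diag !mxE.
  rewrite mulrAC -expr2 ler_piMr ?sqr_ge0//.
  by rewrite lern1 leq_b1.
- transitivity (S *m W^T *m (W *m G *m W^T) *m P^T).
    by rewrite {1}GE trmx_mul !mulmxA.
  by rewrite HE trmx_mul !mulmxA -(mulmxA _ P) PP mulmx1.
- have GE' : G = G *m W^T *m W *m S.
    by rewrite -[in LHS]symG {1}GE !trmx_mul trmxK symG symS !mulmxA.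
  transitivity (S *m W^T *m (W *m G *m W^T) *m W *m S).
    by rewrite {1}GE {1}GE' !mulmxA.
  by rewrite HE trmx_mul !mulmxA.
Qed.

(** * Scalar recursions *)

Section scalar_recursion.
Context {R : realFieldType}.
Implicit Types (b x : nat -> R).

(** Summation by parts: what remains is a combination of the [x k], [k < m], with the nonnegative
    weights [b k.+1 - b k], whose sum telescopes to [b m]. The convention [b 0 = 0] gives [x 0] its
    weight [b 1]. *)
Lemma abel_bound b x (Y : R) (m : nat) : b 0%N = 0 ->
  (forall k, (k < m)%N -> b k <= b k.+1) ->
  (forall k, (k < m)%N -> `|x k| <= Y) ->
  `|\sum_(1 <= k < m.+1) b k * (x k - x k.-1) - b m * x m| <= b m * Y.
Proof.
move=> b0; elim: m => [_ _|m IHm bS xY].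
  by rewrite big_nil b0 !mul0r subrr normr0.
rewrite big_nat_recr//= (_ : _ - _ =
  (\sum_(1 <= k < m.+1) b k * (x k - x k.-1) - b m * x m)
  - (b m.+1 - b m) * x m); last by ring.
rewrite (le_trans (ler_normB _ _))// (_ : b m.+1 * Y = b m * Y + (b m.+1 - b m) * Y).
  rewrite lerD//; first by apply: IHm => k km; [apply: bS|apply: xY]; exact: ltnW.
  rewrite normrM ger0_norm ?subr_ge0 ?bS//.
  by rewrite ler_wpM2l ?subr_ge0 ?bS// xY.
ring.
Qed.

(* The case split is on the sign of the coefficient of [x m]: for a large
   eigenvalue [lam] the Crank-Nicolson average makes it negative, and then only
   [b m <= B] keeps the amplification factor below 1. *)
Lemma scalar_step b x (B lam rho tau phi Y : R) (m : nat) :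
  b 0%N = 0 -> (forall k, (k < m)%N -> b k <= b k.+1) -> b m <= B ->
  0 < tau -> tau^-1 <= B -> - rho <= lam -> 0 <= rho -> rho * tau < 2 ->
  (forall k, (k <= m)%N -> `|x k| <= Y) ->
  B * (x m.+1 - x m) + \sum_(1 <= k < m.+1) b k * (x k - x k.-1) =
    - lam * ((x m.+1 + x m) / 2) + phi ->
  `|x m.+1| <= (1 + rho * tau / 2) / (1 - rho * tau / 2) * Y +
               tau / (1 - rho * tau / 2) * `|phi|.
Proof.
move=> b0 bS bB tau0 tauB lamrho rho0 rhotau xY.
have := abel_bound b0 bS (fun k km => xY k (ltnW km)).
set A := (X in `|X|) => AY eqx.
have Y0 : 0 <= Y by apply: le_trans (xY 0%N isT).
have bm0 : 0 <= b m.
  elim: (m) bS => [_|k IHk bS]; first by rewrite b0.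
  by rewrite (le_trans (IHk _) (bS _ _))// => j jk; apply: bS; exact: ltnW.
have B0 : 0 < B by apply: lt_le_trans tauB; rewrite invr_gt0.
have tauB1 : 1 <= B * tau by rewrite -ler_pdivrMr// div1r.
have den0 : 0 < 1 - rho * tau / 2 by lra.
have D0 : 0 < B + lam / 2.
  have : rho < 2 * B by nra.
  lra.
have xE : (B + lam / 2) * x m.+1 = (B - b m - lam / 2) * x m - A + phi.
  have eA : \sum_(1 <= k < m.+1) b k * (x k - x k.-1) = A + b m * x m.
    by rewrite /A subrK.
  by move: eqx; rewrite eA => eqx; lra.
have phi0 : 0 <= `|phi| by [].
have H : (B + lam / 2) * `|x m.+1| <= `|B - b m - lam / 2| * Y + b m * Y + `|phi|.
  rewrite -[B + _]gtr0_norm// -normrM xE (le_trans (ler_normD _ _))// lerD2r.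
  rewrite (le_trans (ler_normB _ _))// lerD// normrM ler_wpM2l//.
  exact: xY.
rewrite mulrAC [X in _ + X]mulrAC -mulrDl ler_pdivlMr//.
have xm0 : 0 <= `|x m.+1| by [].
have rt0 : 0 <= rho * tau by rewrite mulr_ge0// ltW.
have tp0 : 0 <= tau * `|phi| by rewrite mulr_ge0// ltW.
have rtx : 0 <= rho * tau * `|x m.+1| by rewrite mulr_ge0.
have rtY : 0 <= rho * tau * Y by rewrite mulr_ge0.
have small : `|x m.+1| <= Y + tau * `|phi| ->
    `|x m.+1| * (1 - rho * tau / 2) <= (1 + rho * tau / 2) * Y + tau * `|phi|.
  by move=> ?; lra.
(* In the first case the two occurrences of [b m] cancel and leave [B - lam / 2]. In the second
   [lam] is positive, and [b m <= B] bounds the coefficient [2 b m - B + lam / 2] of [Y] by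
   [B + lam / 2]. *)
have [h|h] := lerP 0 (B - b m - lam / 2).
  rewrite (ger0_norm h) in H.
  have H1 : (B + lam / 2) * `|x m.+1| <= (B - lam / 2) * Y + `|phi| by lra.
  have [xleY|Yltx] := leP `|x m.+1| Y.
    by apply: small; lra.
  have H2 : (B - rho / 2) * `|x m.+1| <= (B + rho / 2) * Y + `|phi| by nra.
  have H3 : B * (`|x m.+1| - Y) <= rho / 2 * (`|x m.+1| + Y) + `|phi| by lra.
  have H4 : (B * tau) * (`|x m.+1| - Y) <=
     tau * (rho / 2 * (`|x m.+1| + Y) + `|phi|).
    by rewrite (mulrC B) -(mulrA _ B) ler_wpM2l// ltW.
  (* Multiplying the positive excess over [Y] by [B tau >= 1] only enlarges it, and puts the factor
     [tau] in front of the source. *)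
  have H5 : `|x m.+1| - Y <= (B * tau) * (`|x m.+1| - Y).
    by rewrite ler_peMl// subr_ge0 ltW.
  have := le_trans H5 H4.
  lra.
rewrite (ltr0_norm h) in H.
have H1 : (B + lam / 2) * (`|x m.+1| - Y) <= `|phi|.
  have : b m * Y <= B * Y by rewrite ler_wpM2r.
  lra.
apply: small.
have lam0 : 0 <= lam by lra.
have [xleY|Yltx] := leP `|x m.+1| Y; first by lra.
rewrite -lerBlDl; apply: (@le_trans _ _ (B * tau * (`|x m.+1| - Y))).
  by rewrite ler_peMl// subr_ge0 ltW.
rewrite (mulrC B) -(mulrA _ B) ler_wpM2l ?(ltW tau0)// (le_trans _ H1)//.
by rewrite ler_wpM2r ?subr_ge0 ?(ltW Yltx)//; lra.
Qed.

End scalar_recursion.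

(** * Euclidean norm over the modes and the Gronwall argument *)

Section euclidean_norm.
Context {R : rcfType} {I : finType}.
Implicit Types z w : I -> R.

Definition l2norm z : R := Num.sqrt (\sum_i z i ^+ 2).

Lemma l2norm_sqr z : l2norm z ^+ 2 = \sum_i z i ^+ 2.
Proof. by rewrite sqr_sqrtr// sumr_ge0// => i _; exact: sqr_ge0. Qed.

Lemma l2norm_ge0 z : 0 <= l2norm z. Proof. exact: sqrtr_ge0. Qed.

Lemma ler_l2norm z w : (forall i, `|z i| <= w i) -> l2norm z <= l2norm w.
Proof.
move=> zw; rewrite ler_wsqrtr// ler_sum// => i _.
by rewrite -real_normK ?num_real// lerXn2r// nnegrE// (le_trans _ (zw i)).
Qed.

(** With [a], [b] the two norms and [c] the inner product, the sum of the squares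
    [(b z_i - a w_i)^2] is [2 a b (a b - c)]. Division by [a b] fails only if one vector is zero. *)
Lemma l2_cauchy_schwarz z w : \sum_i z i * w i <= l2norm z * l2norm w.
Proof.
set a := l2norm z; set b := l2norm w; set c := (X in X <= _).
have a0 : 0 <= a by exact: l2norm_ge0.
have b0 : 0 <= b by exact: l2norm_ge0.
have H : 0 <= 2 * (a * b) * (a * b - c).
  rewrite (_ : _ * _ = \sum_i (b * z i - a * w i) ^+ 2).
    by rewrite sumr_ge0// => i _; exact: sqr_ge0.
  under eq_bigr do rewrite sqrrB !exprMn.
  rewrite !big_split/= sumrN -!mulr_sumr -!l2norm_sqr -/a -/b.
  rewrite (_ : \sum_i _ = a * b * c *+ 2); first by ring.
  rewrite sumrMnl; congr (_ *+ _); rewrite /c mulr_sumr.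
  by apply: eq_bigr => i _; ring.
have [ab0|ab0] := ltP 0 (a * b).
  by rewrite -subr_ge0 -(pmulr_rge0 _ (_ : 0 < 2 * (a * b)))// mulr_gt0.
have /eqP : a * b = 0 by apply/eqP; rewrite eq_le ab0 mulr_ge0.
rewrite mulf_eq0 /c => /orP[] /eqP n0.
  have z0 i : z i = 0.
    have /eqP := l2norm_sqr z; rewrite -/a n0 expr0n/= eq_sym psumr_eq0.
      by move=> /allP/(_ i (mem_index_enum i)); rewrite /= sqrf_eq0 => /eqP.
    by move=> j _; exact: sqr_ge0.
  by rewrite big1 ?mulr_ge0// => i _; rewrite z0 mul0r.
have w0 i : w i = 0.
  have /eqP := l2norm_sqr w; rewrite -/b n0 expr0n/= eq_sym psumr_eq0.
    by move=> /allP/(_ i (mem_index_enum i)); rewrite /= sqrf_eq0 => /eqP.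
  by move=> j _; exact: sqr_ge0.
by rewrite big1 ?mulr_ge0// => i _; rewrite w0 mulr0.
Qed.

Lemma l2norm_lin z w (a b : R) : 0 <= a -> 0 <= b ->
  l2norm (fun i => a * z i + b * w i) <= a * l2norm z + b * l2norm w.
Proof.
move=> a0 b0; rewrite -(@ler_pXn2r _ 2) ?nnegrE ?l2norm_ge0//; last first.
  by rewrite addr_ge0// mulr_ge0// l2norm_ge0.
rewrite l2norm_sqr sqrrD !exprMn !l2norm_sqr.
under eq_bigr do rewrite sqrrD !exprMn.
rewrite !big_split/= -!mulr_sumr lerD2r lerD2l.
rewrite (_ : \sum_i _ = a * b * (\sum_i z i * w i)).
  rewrite -mulr2n lerMn2r/= mulrACA ler_wpM2l ?mulr_ge0//.
  exact: l2_cauchy_schwarz.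
by rewrite mulr_sumr; apply: eq_bigr => i _; rewrite mulrACA.
Qed.

(* The modewise majorants obey a linear recursion with nonnegative
   coefficients, so Minkowski's inequality transfers it to their norm. *)
Lemma amplitude_bound (x phi : I -> nat -> R) (F p q : nat -> R) (M : nat) :
  (forall n, 1 <= q n) -> (forall n, 0 <= p n) ->
  (forall n i Y, (n < M)%N -> (forall k, (k <= n)%N -> `|x i k| <= Y) ->
     `|x i n.+1| <= q n.+1 * Y + p n.+1 * `|phi i n.+1|) ->
  (forall n, (n < M)%N -> l2norm (phi^~ n.+1) <= F n.+1) ->
  exists W : nat -> R, [/\ W 0%N = l2norm (x^~ 0%N),
    (forall n, W n.+1 = q n.+1 * W n + p n.+1 * F n.+1) &
    forall n, (n <= M)%N -> l2norm (x^~ n) <= W n].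
Proof.
move=> q1 p0 Hx HF.
pose Z i := fix Z n := if n is n'.+1 then q n * Z n' + p n * `|phi i n| else `|x i 0%N|.
pose W := fix W n := if n is n'.+1 then q n * W n' + p n * F n else l2norm (x^~ 0%N).
have q0 n : 0 <= q n by rewrite (le_trans ler01).
have Z0 i n : 0 <= Z i n.
  by elim: n => [|n IHn] //=; rewrite addr_ge0// mulr_ge0.
(* [q >= 1] makes the majorant nondecreasing, so its latest value bounds the whole history, as the
   hypothesis [Hx] requires. *)
have ZS i n : Z i n <= Z i n.+1.
  rewrite /= -[leLHS]addr0 lerD ?mulr_ge0//.
  by rewrite ler_peMl.
have xZ i n : (n <= M)%N -> forall k, (k <= n)%N -> `|x i k| <= Z i n.
  elim: n => [_ k|n IHn nM k].
    by rewrite leqn0 => /eqP ->.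
  rewrite leq_eqVlt => /predU1P[->|kn].
    by apply: Hx => // j jn; apply: IHn => //; exact: ltnW.
  by rewrite (le_trans _ (ZS i n))// IHn// ltnW.
have ZW n : (n <= M)%N -> l2norm (Z^~ n) <= W n.
  elim: n => [_|n IHn nM].
    rewrite /= /l2norm; under eq_bigr do rewrite real_normK ?num_real//.
    by [].
  rewrite (le_trans (l2norm_lin _ _ _ _))//= lerD// ler_wpM2l//.
    by apply: IHn; exact: ltnW.
  rewrite (le_trans _ (HF n nM))// /l2norm.
  by under eq_bigr do rewrite real_normK ?num_real//.
exists W; split=> // n nM; apply: le_trans (ZW n nM).
by apply: ler_l2norm => i; apply: (xZ i n nM).
Qed.

End euclidean_norm.

(** Each factor [q] is absorbed by [1 + x <= exp x], and the exponents add up to [kap * t n]; a new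
    source term merely gains a factor at least 1. *)
Lemma discrete_gronwall (R : realType) (W F t p q : nat -> R) (kap c : R)
    (M : nat) :
  0 <= kap -> 0 <= c -> 0 <= W 0%N -> t 0%N = 0 ->
  (forall n, (n < M)%N -> t n <= t n.+1) ->
  (forall n, 0 <= F n) ->
  (forall n, (n < M)%N -> 0 <= q n.+1 <= 1 + kap * (t n.+1 - t n)) ->
  (forall n, (n < M)%N -> p n.+1 <= c * (t n.+1 - t n)) ->
  (forall n, W n.+1 = q n.+1 * W n + p n.+1 * F n.+1) ->
  forall n, (n <= M)%N -> W n <= expR (kap * t n) *
    (W 0%N + c * \sum_(1 <= j < n.+1) (t j - t j.-1) * F j).
Proof.
move=> kap0 c0 W0 t0 tS F0 Hq Hp WS.
have tn0 n : (n <= M)%N -> 0 <= t n.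
  elim: n => [|n IHn] nM; first by rewrite t0.
  by rewrite (le_trans (IHn (ltnW nM)))// tS.
elim=> [_|n IHn nM]; first by rewrite big_nil t0 !mulr0 expR0 mul1r addr0.
have /andP[q0 q1] := Hq n nM.
rewrite WS big_nat_recr//= [c * (_ + _)]mulrDr addrA mulrDr lerD//; last first.
  rewrite (@le_trans _ _ (c * (t n.+1 - t n) * F n.+1))//.
    by rewrite ler_wpM2r// Hp.
  rewrite -mulrA ler_peMl ?mulr_ge0 ?subr_ge0 ?tS//.
  by rewrite -expR0 ler_expR mulr_ge0// tn0.
set U := _ + c * _ in IHn *.
have U0 : 0 <= U.
  rewrite addr_ge0// mulr_ge0// big_nat sumr_ge0// => j /andP[j1 jn].
  rewrite mulr_ge0// subr_ge0; case: j j1 jn => // j _ jn.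
  by rewrite tS// (leq_trans _ nM)// -ltnS ltnW.
apply: (@le_trans _ _ (q n.+1 * (expR (kap * t n) * U))).
  by rewrite ler_wpM2l// IHn// ltnW.
rewrite mulrA ler_wpM2r// (_ : kap * t n.+1 = kap * (t n.+1 - t n) + kap * t n).
  rewrite expRD ler_wpM2r ?expR_ge0// (le_trans q1)//.
  exact: expR_ge1Dx.
by rewrite -mulrDr subrK.
Qed.

(** * Lebesgue measure and test functions *)

Section euclidean_measurability.
Context {R : realType} {d : nat}.
Implicit Types (u w phi : 'rV[R]_d -> R).

Lemma measurable_coord (j : 'I_d) :
  measurable_fun [set: 'rV[R]_d] (fun x : 'rV[R]_d => x ord0 j).
Proof.
move=> _ Y mY; rewrite setTI; apply: sub_sigma_algebra => /=.
rewrite -bigcup_seq/=; exists j => /=; first by rewrite mem_index_enum.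
by exists Y => //; rewrite setTI.
Qed.

Lemma measurable_box (I : 'I_d -> set R) : (forall j, measurable (I j)) ->
  measurable [set x : 'rV[R]_d | forall j, I j (x ord0 j)].
Proof.
move=> mI; rewrite (_ : [set _ | _] =
    \bigcap_(j in [set: 'I_d]) ((fun x : 'rV[R]_d => x ord0 j) @^-1` I j)).
  apply: fin_bigcap_measurable => // j _.
  by rewrite -[X in measurable X]setTI; exact: measurable_coord.
by apply/seteqP; split=> x /= Ix; [move=> j _|move=> j]; exact: Ix.
Qed.

Lemma measurable_rv_ball (x : 'rV[R]_d) (e : R) : measurable (ball x e).
Proof.
have [e0|e0] := leP e 0.
  rewrite (_ : ball x e = set0)//.
  by apply/seteqP; split=> // y []; rewrite ltNge e0.
rewrite (_ : ball x e = [set y : 'rV[R]_d | forall j, ball (x ord0 j) e (y ord0 j)]).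
  by apply: (measurable_box (I := fun j => ball (x ord0 j) e)) => j;
    exact: measurable_ball.
apply/seteqP; split=> [y [_ H] j|y H]; first exact: H.
by split=> // i j; rewrite ord1.
Qed.

(** The sigma-algebra is generated by coordinates, so openness helps only through countability: an
    open set is the union of the balls it contains with rational centre and radius [1 / (n + 1)],
    and these balls are boxes. *)
Lemma open_measurable_rv (U : set 'rV[R]_d) : open U -> measurable U.
Proof.
move=> oU.
pose c (p : 'rV[rat]_d * nat) : 'rV[R]_d := map_mx ratr p.1.
pose D := [set p | ball (c p) p.2.+1%:R^-1 `<=` U].
rewrite (_ : U = \bigcup_(p in D) ball (c p) p.2.+1%:R^-1).
  rewrite bigcup_mkcond; apply: countable_bigcupT_measurable => // p.
  by case: ifPn => // _; exact: measurable_rv_ball.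
apply/seteqP; split=> [x Ux|x [p Dp xp]]; last exact: Dp.
have [e /= e0 eU] := (nbhs_ballP x U).1 (open_nbhs_nbhs (conj oU Ux)).
have [n /= ne] : exists n : nat, n.+1%:R^-1 < e / 2.
  have [n _ H] := near_infty_natSinv_lt (PosNum (divr_gt0 e0 (ltr0Sn R 1))).
  by exists n; exact: (H n (leqnn n)).
have n0 : 0 < n.+1%:R^-1 :> R by rewrite invr_gt0.
have [q xq] : exists q : 'rV[rat]_d, forall j,
    `|ratr (q ord0 j) - x ord0 j| < n.+1%:R^-1.
  have H j : exists q : rat, `|ratr q - x ord0 j| < n.+1%:R^-1.
    have xn : x ord0 j < x ord0 j + n.+1%:R^-1 by rewrite ltrDl.
    have [q /itvP qx] := rat_in_itvoo xn.
    exists q; rewrite ger0_norm ?subr_ge0 ?qx//.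
    by rewrite ltrBlDl qx.
  have [f Hf] := choice H.
  by exists (\row_j f j) => j; rewrite mxE.
have bx : ball (c (q, n)) n.+1%:R^-1 x.
  by split=> // i j; rewrite !ord1 /ball/= mxE; exact: xq.
exists (q, n) => //= y qy; apply: eU.
rewrite (splitr e); apply: (ball_triangle (y := c (q, n))).
  by apply: ball_sym; apply: le_ball bx; exact: ltW.
by apply: le_ball qy; exact: ltW.
Qed.

Lemma continuous_measurable_rv u : continuous u -> measurable_fun setT u.
Proof.
move=> /continuousP cu; apply: (measurability _ (RGenOpens.measurableE R)).
move=> _ [_ [a [b ->] <-]]; rewrite setTI; apply: open_measurable_rv.
exact/cu/interval_open.
Qed.

End euclidean_measurability.

(** Induction along the recursive definition of the measure: the preimage of a box under [rv_rcons]
    is a lower-dimensional box times an interval. This is what makes compactly supported continuous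
    functions square integrable. *)
Lemma lebesgue_rv_box_lty (R : realType) (d : nat) (N : R) :
  (lebesgue_rv R d [set x : 'rV[R]_d | (forall j, x ord0 j \in `[- N, N])%R]
     < +oo)%E.
Proof.
have mI (m : nat) : measurable
    [set x : 'rV[R]_m | forall j, x ord0 j \in `[- N, N]].
  by apply: (measurable_box (I := fun=> [set` `[- N, N]])) => j; exact: measurable_itv.
elim: d => [|d IHd]; first by rewrite /= diracE; case: (_ \in _); rewrite ltry.
rewrite /= /lebesgue_rcons /pushforward.
rewrite (_ : _ @^-1` _ =
    [set x : 'rV[R]_d | forall j, x ord0 j \in `[- N, N]] `*` [set` `[- N, N]]).
  rewrite product_measure1E//; last exact: mI.
  rewrite lte_mul_pinfty// ?ge0_fin_numE// [ltLHS]lebesgue_measure_itv/=.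
  by case: ifP; rewrite -?EFinB ltry.
apply/seteqP; split=> -[x t] /=.
  move=> H; split=> [j|].
    by have := H (lift ord_max j); rewrite mxE liftK.
  by have := H ord_max; rewrite mxE unlift_none.
by move=> [H1 H2] j; rewrite mxE; case: unliftP.
Qed.

Section test_functions.
Context {R : realType} {d : nat}.
Variable Omega : set 'rV[R]_d.
Implicit Types (u w phi : 'rV[R]_d -> R) (s : seq 'I_d).

(** The form [a u + w] is kept for all the function spaces below, since finite linear combinations
    follow from it by induction. Iterated derivatives are treated together because [smooth]
    quantifies over them. *)
Lemma foldr_partial_lin u w (a : R) s : smooth u -> smooth w ->
  foldr partial (fun x => a * u x + w x) s =
  (fun x => a * foldr partial u s x + foldr partial w s x).
Proof.
move=> su sw; elim: s => [//|i s IHs].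
rewrite [LHS]/= IHs; apply/funext => x; rewrite /partial.
have du := (su s).2 i x; have dw := (sw s).2 i x.
rewrite (_ : (fun y => _) = a *: foldr partial u s + foldr partial w s)//.
have dau : derivable (a *: foldr partial u s) x (delta_mx ord0 i).
  exact: derivableZ.
by rewrite (deriveD dau dw) (deriveZ _ du).
Qed.

Lemma smooth_lin u w (a : R) : smooth u -> smooth w ->
  smooth (fun x => a * u x + w x).
Proof.
move=> su sw s; rewrite foldr_partial_lin//.
have [cu du] := su s; have [cw dw] := sw s; split.
  by move=> x; exact: (cvgD (cvgM (cvg_cst a) (cu x)) (cw x)).
move=> i x.
rewrite (_ : (fun y => _) = a *: foldr partial u s + foldr partial w s)//.
by apply: derivableD => //; exact: derivableZ.
Qed.

Lemma test_function_lin u w (a : R) :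
  test_function Omega u -> test_function Omega w ->
  test_function Omega (fun x => a * u x + w x).
Proof.
move=> [su [Ku [cKu KuO] u0]] [sw [Kw [cKw KwO] w0]].
split; first exact: smooth_lin.
exists (Ku `|` Kw).
  by split; [exact: compactU|rewrite subUset].
by move=> x /not_orP[nu nw]; rewrite u0// w0// mulr0 addr0.
Qed.

Lemma foldr_partial_support (K : set 'rV[R]_d) phi s : closed K ->
  (forall x, ~ K x -> phi x = 0) -> forall x, ~ K x -> foldr partial phi s x = 0.
Proof.
move=> cK phi0; elim: s => [//|i s IHs] x nKx /=.
rewrite /partial (@near_eq_derive _ _ _ _ (cst 0)) ?derive_cst//.
have oK : open (~` K) by exact: closed_openC.
have : nbhs x (~` K) by exact: open_nbhs_nbhs.
by apply: filterS => y /IHs ->.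
Qed.

Lemma test_function_partial phi i :
  test_function Omega phi -> test_function Omega (partial i phi).
Proof.
move=> [sphi [K [cK KO] phi0]]; split.
  by move=> s; have := sphi (rcons s i); rewrite foldr_rcons.
exists K => // x nKx; apply: (@foldr_partial_support K phi [:: i]) => //.
apply: compact_closed => //; exact: norm_hausdorff.
Qed.

(** Integrability of the products with test functions is what allows the integrals defining weak
    gradients to be split linearly. The dominating function is a constant on a box containing the
    support. *)
Lemma test_function_L2 phi : test_function Omega phi -> L2 Omega phi.
Proof.
move=> [sphi [K [cK KO] phi0]].
have cphi : continuous phi := (sphi [::]).1.
have mphi : measurable_fun setT phi := continuous_measurable_rv cphi.
have -> : L2 Omega phi = (phi \in Lfun (lebesgue_rv R d) 2%:E).
  rewrite /L2 (_ : phi \_ Omega = phi)//; apply/funext => x; rewrite patchE.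
  case: ifPn => // /negP xO; apply/esym/phi0 => Kx; apply: xO.
  by rewrite inE; exact: KO.
have [C C0 phiC] : exists2 C : R, 0 < C & forall x, `|phi x| <= C.
  have : bounded_set (phi @` K).
    apply: compact_bounded; apply: continuous_compact => //.
    exact: continuous_subspaceT.
  move=> -[M [_ HM]]; have := HM (M + 1); rewrite ltrDl ltr01 => /(_ isT) HC.
  exists (Num.max (M + 1) 1); first by rewrite lt_max ltr01 orbT.
  move=> x; have [Kx|nKx] := pselect (K x).
    by rewrite le_max HC//; exists x.
  by rewrite phi0// normr0 le_max ler01 orbT.
have [N KN] : exists N : R, forall x, K x -> forall j, x ord0 j \in `[- N, N].
  have [M [_ HM]] := compact_bounded cK.
  have := HM (M + 1); rewrite ltrDl ltr01 => /(_ isT) HN.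
  exists (M + 1) => x Kx j; rewrite in_itv/= -ler_norml (le_trans _ (HN _ Kx))//.
  rewrite [leRHS]/Num.norm/= mx_normrE; apply/bigmax_geP; right => /=.
  by exists (ord0, j).
have mB := measurable_box (I := fun=> [set` `[- N, N]])
  (fun j : 'I_d => measurable_itv _).
set B := [set x : 'rV[R]_d | _] in mB.
rewrite inE; apply/andP; split; rewrite inE//= /finite_norm.
rewrite unlock /Lnorm poweR_lty//.
rewrite (@le_lt_trans _ _ (\int[lebesgue_rv R d]_(x in B) (C `^ 2)%:E))%E//.
  rewrite [leRHS]integral_mkcond; apply: ge0_le_integral => //=.
  - apply/measurable_EFinP; apply: (measurableT_comp (measurable_powR _)) => //.
    exact: measurableT_comp.
  - exact/(measurable_restrictT _ mB).
  - move=> x _; rewrite patchE; case: ifPn => [_|/negP xB].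
      by rewrite lee_fin ge0_ler_powR// nnegrE ?(ltW C0).
    rewrite phi0 ?normr0 ?powR0//= => Kx; apply: xB; rewrite inE => j.
    exact: KN.
  rewrite integral_cst// lte_mul_pinfty ?lee_fin ?powR_ge0//.
  exact: lebesgue_rv_box_lty.
Qed.

End test_functions.

(** * L2 and H01 *)

Section L2_space.
Context {R : realType} {d : nat}.
Variable Omega : set 'rV[R]_d.
Implicit Types (u w z : 'rV[R]_d -> R) (a : R).

Local Notation leb := (lebesgue_rv R d).

Lemma patch_lin u w a : (fun x => a * u x + w x) \_ Omega =
  (fun x => a * (u \_ Omega) x + (w \_ Omega) x).
Proof.
by apply/funext => x; rewrite !patchE; case: ifPn; rewrite ?mulr0 ?addr0.
Qed.

Lemma L2_lin u w a : L2 Omega u -> L2 Omega w ->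
  L2 Omega (fun x => a * u x + w x).
Proof.
move=> Lu Lw; rewrite /L2 patch_lin.
exact: ((Lfun_submod_closed leb (lee1n 2)).2 a _ _ Lu Lw).
Qed.

Lemma L2_0 : L2 Omega (fun=> 0).
Proof.
rewrite /L2 (_ : _ \_ Omega = (0 : 'rV[R]_d -> R)).
  exact: (Lfun_submod_closed leb (lee1n 2)).1.
by apply/funext => x; rewrite patchE; case: ifP.
Qed.

Lemma L2enorm_ge0 u : (0 <= L2enorm Omega u)%E.
Proof. exact: Lnorm_ge0. Qed.

Lemma L2enorm_lin u w a : L2 Omega u -> L2 Omega w ->
  (L2enorm Omega (fun x => (a * u x + w x)%R) <=
   `|a|%:E * L2enorm Omega u + L2enorm Omega w)%E.
Proof.
move=> Lu Lw; rewrite /L2enorm patch_lin.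
have := LnormZ (Lfun_Sub (lee1n 2) Lu) a; rewrite Lfun_valP => <-.
have Lau : a *: (u \_ Omega) \in Lfun leb 2%:E.
  rewrite -[_ *: _]addr0; apply: (Lfun_submod_closed leb (lee1n 2)).2 => //.
  exact: (Lfun_submod_closed leb (lee1n 2)).1.
apply: (@eminkowski _ _ _ leb (a *: (u \_ Omega)) (w \_ Omega)); last exact: (lee1n 2).
  by move: Lau => /sub_Lfun_mfun; rewrite inE.
by move: Lw => /sub_Lfun_mfun; rewrite inE.
Qed.

Lemma L2innerE u w :
  L2inner Omega u w = \int[leb]_x ((u \_ Omega) x * (w \_ Omega) x).
Proof.
rewrite /L2inner Rintegral_mkcond; apply: eq_Rintegral => x _.
by rewrite !patchE; case: ifP; rewrite ?mulr0.
Qed.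

Lemma L2_mul_integrable u w : L2 Omega u -> L2 Omega w ->
  leb.-integrable setT (fun x => ((u \_ Omega) x * (w \_ Omega) x)%:E).
Proof. by move=> Lu Lw; exact/Lfun1_integrable/Lfun2_mul_Lfun1. Qed.

Lemma L2innerC u w : L2inner Omega u w = L2inner Omega w u.
Proof. by rewrite !L2innerE; under eq_Rintegral do rewrite mulrC. Qed.

Lemma L2inner_linl u w z a : L2 Omega u -> L2 Omega w -> L2 Omega z ->
  L2inner Omega (fun x => a * u x + w x) z =
  a * L2inner Omega u z + L2inner Omega w z.
Proof.
move=> Lu Lw Lz; rewrite !L2innerE patch_lin.
under eq_Rintegral do rewrite mulrDl -mulrA.
rewrite RintegralD ?RintegralZl//; first exact: L2_mul_integrable.
- exact: integrableZl (L2_mul_integrable Lu Lz).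
- exact: L2_mul_integrable.
Qed.

Lemma L2norm_ge0 u : 0 <= L2norm Omega u.
Proof. exact/fine_ge0/L2enorm_ge0. Qed.

Lemma L2norm_sqr u : L2 Omega u -> L2norm Omega u ^+ 2 = L2inner Omega u u.
Proof.
move=> Lu; rewrite L2innerE -powR_mulrn ?L2norm_ge0// /L2norm -fine_poweR.
rewrite /L2enorm powR_Lnorm// /Rintegral; congr fine.
apply: eq_integral => x _ /=; congr EFin.
by rewrite powR_mulrn// -normrX expr2 ger0_norm// -expr2 sqr_ge0.
Qed.

End L2_space.

Section H01_space.
Context {R : realType} {d : nat}.
Variable Omega : set 'rV[R]_d.
Implicit Types (u w z : 'rV[R]_d -> R) (a : R) (g h : 'I_d -> 'rV[R]_d -> R).

Lemma L2inner_0l w : L2inner Omega (fun=> 0) w = 0.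
Proof.
rewrite /L2inner; under eq_Rintegral do rewrite mul0r.
by rewrite /Rintegral integral0.
Qed.

Lemma weak_gradient_0 : weak_gradient Omega (fun=> 0) (fun _ _ => 0).
Proof.
by split=> [i|phi i _]; [exact: L2_0|rewrite !L2inner_0l oppr0].
Qed.

Lemma weak_gradient_lin u w g h a : L2 Omega u -> L2 Omega w ->
  weak_gradient Omega u g -> weak_gradient Omega w h ->
  weak_gradient Omega (fun x => a * u x + w x) (fun i x => a * g i x + h i x).
Proof.
move=> Lu Lw [Lg gE] [Lh hE]; split=> [i|phi i tphi]; first exact: L2_lin.
have Lphi := test_function_L2 tphi.
have Ldphi := test_function_L2 (test_function_partial i tphi).
by rewrite !L2inner_linl// gE// hE// mulrN opprD.
Qed.

Lemma cvg_L2enorm_lin (u_ w_ : nat -> 'rV[R]_d -> R) u w a :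
  (forall k, L2 Omega (u_ k)) -> (forall k, L2 Omega (w_ k)) ->
  L2 Omega u -> L2 Omega w ->
  L2enorm Omega (u_ k \- u) @[k --> \oo] --> 0%E ->
  L2enorm Omega (w_ k \- w) @[k --> \oo] --> 0%E ->
  L2enorm Omega ((fun x => a * u_ k x + w_ k x) \- (fun x => a * u x + w x))
    @[k --> \oo] --> 0%E.
Proof.
move=> Lu_ Lw_ Lu Lw u_u w_w.
have LB f f' : L2 Omega f -> L2 Omega f' -> L2 Omega (f \- f').
  move=> Lf Lf'; rewrite (_ : _ \- _ = fun x => -1 * f' x + f x).
    exact: L2_lin.
  by apply/funext => x; rewrite mulN1r addrC.
apply: (@squeeze_cvge _ _ _ _ (cst 0%E) _
  (fun k => `|a|%:E * L2enorm Omega (u_ k \- u)%R + L2enorm Omega (w_ k \- w)%R)%E).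
- near=> k; rewrite L2enorm_ge0/=.
  rewrite (_ : _ \- _ = fun x => a * (u_ k \- u) x + (w_ k \- w) x).
    by apply: L2enorm_lin; exact: LB.
  by apply/funext => x /=; rewrite mulrBr opprD addrACA.
- exact: cvg_cst.
- rewrite -[X in _ --> X]adde0 -[X in _ --> (X + _)%E](mule0 `|a|%:E).
  by apply: cvgeD => //; exact: cvgeZl.
Unshelve. all: by end_near. Qed.

Lemma H01_lin u w a : H01 Omega u -> H01 Omega w ->
  H01 Omega (fun x => a * u x + w x).
Proof.
move=> [Lu [g gu [p [tp pu pg]]]] [Lw [h hw [q [tq qw qh]]]].
split; first exact: L2_lin.
exists (fun i x => a * g i x + h i x); first exact: weak_gradient_lin.
exists (fun k x => a * p k x + q k x); split=> [k||i].
- exact: test_function_lin.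
- by apply: cvg_L2enorm_lin => // k; exact: test_function_L2.
- have pE k : partial i (fun x => a * p k x + q k x) =
      fun x => a * partial i (p k) x + partial i (q k) x.
    exact: (@foldr_partial_lin _ _ _ _ a [:: i] (tp k).1 (tq k).1).
  under eq_fun do rewrite pE.
  apply: cvg_L2enorm_lin => //.
  + by move=> k; exact/test_function_L2/test_function_partial.
  + by move=> k; exact/test_function_L2/test_function_partial.
  + exact: gu.1.
  + exact: hw.1.
Qed.

Section L2_linear_combinations.
Variables (I : Type) (v : I -> 'rV[R]_d -> R).
Hypothesis Lv : forall k, L2 Omega (v k).
Implicit Types (s : seq I) (c : I -> R).

Lemma L2_sum s c : L2 Omega (fun x => \sum_(k <- s) c k * v k x).
Proof.
elim: s => [|k s IHs].
  by under eq_fun do rewrite big_nil; exact: L2_0.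
by under eq_fun do rewrite big_cons; exact: L2_lin.
Qed.

Lemma L2inner_suml s c w : L2 Omega w ->
  L2inner Omega (fun x => \sum_(k <- s) c k * v k x) w =
  \sum_(k <- s) c k * L2inner Omega (v k) w.
Proof.
move=> Lw; elim: s => [|k s IHs].
  by under [X in L2inner _ X]eq_fun do rewrite big_nil; rewrite L2inner_0l big_nil.
under [X in L2inner _ X]eq_fun do rewrite big_cons.
by rewrite L2inner_linl ?IHs ?big_cons//; exact: L2_sum.
Qed.

Lemma L2inner_sumr s c w : L2 Omega w ->
  L2inner Omega w (fun x => \sum_(k <- s) c k * v k x) =
  \sum_(k <- s) c k * L2inner Omega w (v k).
Proof.
move=> Lw; rewrite L2innerC L2inner_suml//.
by apply: eq_bigr => k _; rewrite L2innerC.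
Qed.

End L2_linear_combinations.

Section H01_linear_combinations.
Variables (I : Type) (v : I -> 'rV[R]_d -> R) (g : I -> 'I_d -> 'rV[R]_d -> R).
Hypothesis Hv : forall k, H01 Omega (v k).
Hypothesis gv : forall k, weak_gradient Omega (v k) (g k).
Implicit Types (s : seq I) (c : I -> R).

Lemma weak_gradient_sum s c : weak_gradient Omega
  (fun x => \sum_(k <- s) c k * v k x)
  (fun i x => \sum_(k <- s) c k * g k i x).
Proof.
elim: s => [|k s IHs].
  under eq_fun do rewrite big_nil.
  under [X in weak_gradient _ _ X]eq_fun do under eq_fun do rewrite big_nil.
  exact: weak_gradient_0.
under eq_fun do rewrite big_cons.
under [X in weak_gradient _ _ X]eq_fun do under eq_fun do rewrite big_cons.
by apply: weak_gradient_lin => //; [exact: (Hv k).1|apply: L2_sum => j; exact: (Hv j).1].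
Qed.

(** The index [k0] serves the empty sum: the zero function is reached as [- v k0 + v k0]. *)
Lemma H01_sum (k0 : I) s c : H01 Omega (fun x => \sum_(k <- s) c k * v k x).
Proof.
elim: s => [|k s IHs].
  rewrite (_ : (fun x => _) = fun x => -1 * v k0 x + v k0 x).
    exact: H01_lin.
  by apply/funext => x; rewrite big_nil mulN1r addNr.
by under eq_fun do rewrite big_cons; exact: H01_lin.
Qed.

End H01_linear_combinations.
End H01_space.

(** * Decomposition into modes *)

Section modes.
Context {R : realType} {d : nat}.
Variable Omega : set 'rV[R]_d.
Implicit Types (u w : 'rV[R]_d -> R) (g h : 'I_d -> 'rV[R]_d -> R).

Lemma L2vinnerC g h : L2vinner Omega g h = L2vinner Omega h g.
Proof. by apply: eq_bigr => i _; exact: L2innerC. Qed.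

Lemma L2inner_ge0 u : 0 <= L2inner Omega u u.
Proof. by apply: Rintegral_ge0 => x _; rewrite -expr2 sqr_ge0. Qed.

Lemma L2vnorm_sqr g : (forall i, L2 Omega (g i)) ->
  L2vnorm Omega g ^+ 2 = L2vinner Omega g g.
Proof.
move=> Lg; rewrite sqr_sqrtr; last by apply: sumr_ge0 => i _; exact: sqr_ge0.
by apply: eq_bigr => i _; rewrite L2norm_sqr.
Qed.

Lemma L2vinner_lin2 g g' h (a b : R) :
  (forall i, L2 Omega (g i)) -> (forall i, L2 Omega (g' i)) ->
  (forall i, L2 Omega (h i)) ->
  L2vinner Omega (fun i x => a * g i x + b * g' i x) h =
  a * L2vinner Omega g h + b * L2vinner Omega g' h.
Proof.
move=> Lg Lg' Lh; rewrite /L2vinner !mulr_sumr -big_split; apply: eq_bigr => i _ /=.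
have Lbg : L2 Omega (fun x => b * g' i x + 0) by apply: L2_lin => //; exact: L2_0.
have -> : (fun x => a * g i x + b * g' i x) = (fun x => a * g i x + (b * g' i x + 0)).
  by apply/funext => x; rewrite addr0.
by rewrite !L2inner_linl ?L2inner_0l ?addr0//; exact: L2_0.
Qed.

Section finite_family.
Variables (n : nat) (v : 'I_n -> 'rV[R]_d -> R) (g : 'I_n -> 'I_d -> 'rV[R]_d -> R).
Hypothesis Hv : forall k, H01 Omega (v k).
Hypothesis gv : forall k, weak_gradient Omega (v k) (g k).

Let Lv k : L2 Omega (v k). Proof. exact: (Hv k).1. Qed.
Let Lg i k : L2 Omega (g k i). Proof. exact: (gv k).1. Qed.

Let G : 'M[R]_n := \matrix_(k, l) L2inner Omega (v k) (v l).
Let S : 'M[R]_n := \matrix_(k, l) L2vinner Omega (g k) (g l).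
Let comb (c : 'rV[R]_n) : 'rV[R]_d -> R := fun x => \sum_k c 0 k * v k x.
Let gcomb (c : 'rV[R]_n) : 'I_d -> 'rV[R]_d -> R :=
  fun i x => \sum_k c 0 k * g k i x.

Let Lcomb c : L2 Omega (comb c). Proof. exact: L2_sum. Qed.

Let inner_comb k c : L2inner Omega (v k) (comb c) = (G *m c^T) k 0.
Proof.
by rewrite L2inner_sumr// mxE; apply: eq_bigr => l _; rewrite !mxE mulrC.
Qed.

Let inner_comb2 c : L2inner Omega (comb c) (comb c) = (c *m G *m c^T) 0 0.
Proof.
rewrite L2inner_suml// -mulmxA [RHS]mxE.
by apply: eq_bigr => k _; rewrite inner_comb.
Qed.

Let vinner_gcomb k c : L2vinner Omega (g k) (gcomb c) = (S *m c^T) k 0.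
Proof.
rewrite /L2vinner mxE.
transitivity (\sum_i \sum_l c 0 l * L2inner Omega (g k i) (g l i)).
  by apply: eq_bigr => i _; rewrite (L2inner_sumr (v := fun l => g l i)).
rewrite exchange_big/=; apply: eq_bigr => l _.
by rewrite !mxE -mulr_sumr mulrC.
Qed.

Let vinner_gcomb2 c : L2vinner Omega (gcomb c) (gcomb c) = (c *m S *m c^T) 0 0.
Proof.
rewrite -mulmxA [RHS]mxE.
transitivity (\sum_i \sum_k c 0 k * L2inner Omega (g k i) (gcomb c i)).
  apply: eq_bigr => i _; rewrite (L2inner_suml (v := fun l => g l i))//.
  exact: (L2_sum (v := fun l => g l i)).
rewrite exchange_big/=; apply: eq_bigr => k _.
by rewrite -mulr_sumr -vinner_gcomb.
Qed.

(* The modes are the generalized eigenvectors of the pair of Gram matrices of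
   the family in L^2 and of its gradients. *)
Theorem H01_modes (CP : R) : poincare Omega CP -> (0 < n)%N ->
  exists (e : 'I_n -> 'rV[R]_d -> R) (ge : 'I_n -> 'I_d -> 'rV[R]_d -> R)
    (th : 'I_n -> R),
  [/\ forall i, H01 Omega (e i) /\ weak_gradient Omega (e i) (ge i),
      forall i, 0 <= th i <= CP ^+ 2,
      forall k i, L2inner Omega (v k) (e i) = th i * L2vinner Omega (g k) (ge i),
      forall k, L2norm Omega (v k) ^+ 2 =
        \sum_i th i * L2vinner Omega (g k) (ge i) ^+ 2 &
      forall f, L2 Omega f ->
        \sum_i L2inner Omega f (e i) ^+ 2 / th i <= L2norm Omega f ^+ 2].
Proof.
move=> [CP0 poinc] n0.
have symG : G^T = G by apply/matrixP => k l; rewrite !mxE L2innerC.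
have symS : S^T = S by apply/matrixP => k l; rewrite !mxE L2vinnerC.
have Hcomb c : H01 Omega (comb c) by exact: (H01_sum Hv (Ordinal n0)).
have gcombP c : weak_gradient Omega (comb c) (gcomb c) by exact: weak_gradient_sum.
have posG (u : 'rV[R]_n) : 0 <= (u *m G *m u^T) 0 0.
  by rewrite -inner_comb2 L2inner_ge0.
(* The Poincaré inequality for every element of the span, read as a comparison of the two Gram
   matrices. *)
have GS (u : 'rV[R]_n) : (u *m G *m u^T) 0 0 <= CP ^+ 2 * (u *m S *m u^T) 0 0.
  rewrite -inner_comb2 -vinner_gcomb2 -L2norm_sqr//.
  rewrite -L2vnorm_sqr -?exprMn; last exact: (gcombP u).1.
  rewrite lerXn2r ?nnegrE ?L2norm_ge0//; last exact: poinc.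
  by rewrite mulr_ge0 ?(ltW CP0)// sqrtr_ge0.
have [E [th [EGE thb GES GE]]] :=
  simultaneous_diagonalization symG symS (exprn_gt0 2 CP0) posG GS.
have SEe k i : (S *m E^T) k i = L2vinner Omega (g k) (gcomb (row i E)).
  rewrite vinner_gcomb tr_row !mxE; apply: eq_bigr => l _; rewrite !mxE.
  by [].
have GEe k i : (G *m E^T) k i = L2inner Omega (v k) (comb (row i E)).
  by rewrite inner_comb tr_row !mxE; apply: eq_bigr => l _; rewrite !mxE.
exists (fun i => comb (row i E)), (fun i => gcomb (row i E)), (th 0); split.
- by move=> i; split.
- exact: thb.
- by move=> k i; rewrite -GEe GES mul_mx_diag mxE SEe mulrC.
- move=> k; rewrite L2norm_sqr// (_ : L2inner _ _ _ = G k k); last by rewrite mxE.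
  rewrite {1}GE mxE; apply: eq_bigr => i _; rewrite mul_mx_diag mxE.
  rewrite (_ : (E *m S) i k = (S *m E^T) k i) ?SEe; last first.
    by rewrite -[S in LHS]trmxK -[E in LHS]trmxK -trmx_mul mxE symS.
  by rewrite mulrAC mulrC expr2.
(* Bessel's inequality: [comb b] is the sum of the [(F i / th i) e i], and both its inner product
   with [f] and its square norm equal the left-hand sum, so that expanding the square of
   [f - comb b] concludes. Null modes contribute 0 because division by 0 gives 0. *)
- move=> f Lf; pose F i := L2inner Omega f (comb (row i E)).
  pose a : 'rV[R]_n := \row_i (F i / th 0 i).
  pose b := a *m E.
  have fb : L2inner Omega f (comb b) = \sum_i F i ^+ 2 / th 0 i.
    rewrite L2inner_sumr//.
    transitivity (\sum_k \sum_i a 0 i * E i k * L2inner Omega f (v k)).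
      by apply: eq_bigr => k _; rewrite mxE mulr_suml.
    rewrite exchange_big/=; apply: eq_bigr => i _.
    have -> : F i ^+ 2 / th 0 i = a 0 i * F i by rewrite mxE expr2 mulrAC.
    rewrite -[X in _ = _ * X]/(L2inner Omega f (comb (row i E))) L2inner_sumr//.
    by rewrite mulr_sumr; apply: eq_bigr => k _; rewrite [row i E 0 k]mxE mulrA.
  have bb : L2inner Omega (comb b) (comb b) = \sum_i F i ^+ 2 / th 0 i.
    rewrite inner_comb2 /b trmx_mul -!mulmxA (mulmxA G) (mulmxA E) (mulmxA E) EGE.
    rewrite mulmxA mul_mx_diag mxE; apply: eq_bigr => i _; rewrite !mxE.
    have [->|t0] := eqVneq (th 0 i) 0; first by rewrite invr0 !mulr0.
    by field.
  have := L2inner_ge0 (fun x => -1 * comb b x + f x).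
  have Lz : L2 Omega (fun x => -1 * comb b x + f x) by exact: L2_lin.
  rewrite L2inner_linl// ![L2inner _ _ (fun x => -1 * _ + _)]L2innerC.
  rewrite !L2inner_linl// bb fb [L2inner _ (comb b) f]L2innerC fb L2norm_sqr//.
  by rewrite -/F; lra.
Qed.

End finite_family.
End modes.

(** * Kernels and the graded mesh *)

Section improper_FTC.
Context {R : realType}.
Notation mu := (@lebesgue_measure R).
Variables (f F : R -> R) (a b : R).
Hypothesis f_ge0 : {in `]a, b[, forall x, 0 <= f x}.
Hypothesis f_cont : {in `]a, b[, continuous f}.
Hypothesis F_deriv : {in `]a, b[, forall x, is_derive x (1 : R) F (f x)}.
Hypothesis F_cont : continuous F.

Let mf : measurable_fun `]a, b[ f.
Proof. by apply: open_continuous_measurable_fun => // x /[!inE]; exact: f_cont. Qed.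

(** The integrand may blow up at an endpoint, as [(t - y)^(-alpha)] does at [y = t]. Compact
    subintervals are exhausted by monotone convergence, for which nonnegativity is used. *)
Lemma ge0_FTC2_oo : a < b ->
  (\int[mu]_(x in `]a, b[) (f x)%:E = (F b)%:E - (F a)%:E)%E.
Proof.
move=> ab.
have h0 : 0 < b - a by rewrite subr_gt0.
(* The shift to [n + 3] keeps [e n] below half the length, so no subinterval degenerates. *)
pose e (n : nat) : R := (b - a) * n.+3%:R^-1.
have e0 n : 0 < e n by rewrite mulr_gt0.
have e2 n : e n < (b - a) / 2 by rewrite ltr_pM2l// ltf_pV2 ?posrE// ltr_nat.
have ecvg : e n @[n --> \oo] --> 0.
  rewrite -[X in _ --> X](mulr0 (b - a)); apply: cvgMr.
  have := @cvg_harmonic R; rewrite -(cvg_shiftn 2); apply: cvg_trans.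
  by apply: near_eq_cvg; near=> n; rewrite /= addn2.
pose A n : set R := [set` `[a + e n, b - e n]].
have Aoo n : A n `<=` `]a, b[.
  move=> x; rewrite /A /= !in_itv/= => /andP[h1 h2].
  by rewrite (lt_le_trans _ h1) ?ltrDl//= (le_lt_trans h2)// gtrBl.
have eS n k : (n <= k)%N -> e k <= e n.
  by move=> nk; rewrite ler_pM2l// lef_pV2 ?posrE// ler_nat.
have IA n : (\int[mu]_(x in A n) (f x)%:E = (F (b - e n))%:E - (F (a + e n))%:E)%E.
  have ab' : a + e n < b - e n by have := e2 n; lra.
  apply: continuous_FTC2 => //.
  - apply: continuous_in_subspaceT => x /[!inE] /Aoo; exact: f_cont.
  - split=> [x xA| |].
    + by have /F_deriv[] : x \in `]a, b[
        by apply: (Aoo n); apply: subset_itv_oo_cc.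
    + by apply: cvg_at_right_filter; exact: F_cont.
    + by apply: cvg_at_left_filter; exact: F_cont.
  - move=> x xA; rewrite derive1E.
    have /F_deriv dx : x \in `]a, b[ by apply: (Aoo n); apply: subset_itv_oo_cc.
    exact: derive_val.
have UA : `]a, b[%classic = \bigcup_n A n.
  apply/seteqP; split=> [x /=|x [n _]]; last exact: Aoo.
  rewrite in_itv/= => /andP[ax xb].
  have m0 : 0 < Num.min (x - a) (b - x) by rewrite lt_min !subr_gt0 ax xb.
  have [n _ Hn] := cvgr_lt 0 ecvg _ m0.
  exists n => //; have := Hn n (leqnn n); rewrite /A/= in_itv/= lt_min => /andP[].
  by move=> *; apply/andP; split; lra.
have cvA : (\int[mu]_(x in A n) (f x)%:E)%E @[n --> \oo] -->
    (\int[mu]_(x in `]a, b[) (f x)%:E)%E.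
  rewrite UA; apply: ge0_nondecreasing_set_cvg_integral.
  - move=> n k nk; rewrite subsetEset => x; rewrite /A/= !in_itv/= => /andP[h1 h2].
    by have := eS _ _ nk => h; apply/andP; split; lra.
  - by move=> n; exact: measurable_itv.
  - move=> n; apply/measurable_EFinP; exact: measurable_funS mf.
  - by move=> n x /Aoo xab; rewrite lee_fin f_ge0.
have cvF : ((F (b - e n))%:E - (F (a + e n))%:E)%E @[n --> \oo] -->
    ((F b)%:E - (F a)%:E)%E.
  rewrite -EFinB; apply: cvg_EFin; first exact: nearW.
  rewrite (_ : fine \o _ = fun n => F (b - e n) - F (a + e n))//.
  have Hb : (b - e n) @[n --> \oo] --> b.
    by rewrite -[X in _ --> X]subr0; apply: cvgB => //; exact: cvg_cst.
  have Ha : (a + e n) @[n --> \oo] --> a.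
    by rewrite -[X in _ --> X]addr0; apply: cvgD => //; exact: cvg_cst.
  by apply: cvgB; (apply: continuous_cvg; [exact: F_cont|]).
move: cvA; under eq_fun do rewrite IA; move=> cvA.
exact: (cvg_unique _ cvA cvF).
Unshelve. all: by end_near. Qed.

Lemma ge0_FTC2_cc : a <= b ->
  (\int[mu]_(x in `[a, b]) (f x)%:E = (F b)%:E - (F a)%:E)%E.
Proof.
rewrite le_eqVlt => /predU1P[<-|ab].
  by rewrite set_itv1 integral_set1 subee.
have mfE : measurable_fun `]a, b[ (EFin \o f) by exact/measurable_EFinP.
by rewrite (integral_itv_bndoo _ _ mfE); exact: ge0_FTC2_oo.
Qed.

End improper_FTC.

Section positive_power.
Context {R : realType}.
Implicit Types (p x y : R).

Lemma is_derive_powR p x : 0 < x -> is_derive x (1 : R) (@powR R ^~ p) (p * x `^ (p - 1)).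
Proof.
move=> x0; have xI : x \in `]0, +oo[ by rewrite in_itv/= x0.
apply: DeriveDef; first exact: derivable_powR.
by rewrite -derive1E; exact: powR_derive1.
Qed.

(* The library's [x `^ p] is 1 for [x < 0]; the positive part makes the power
   continuous on the whole line. *)
Definition pospow p x : R := (Num.max x 0) `^ p.

Lemma pospowE p x : 0 <= x -> pospow p x = x `^ p.
Proof. by move=> x0; rewrite /pospow max_l. Qed.

Lemma is_derive_pospow p x : 0 < x ->
  is_derive x (1 : R) (pospow p) (p * x `^ (p - 1)).
Proof.
move=> x0; apply: (@near_eq_is_derive _ _ _ (@powR R ^~ p)) (is_derive_powR p x0).
near=> y; rewrite pospowE// ltW//; near: y; exact: lt_nbhsr.
Unshelve. all: by end_near. Qed.

Lemma continuous_pospow p : 0 < p -> continuous (pospow p).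
Proof.
move=> p0 x; have [x0|x0|->] := ltgtP x 0.
- rewrite /continuous_at (_ : pospow p x = 0); last first.
    by rewrite /pospow max_r ?(ltW x0)// powR0 ?gt_eqF.
  apply/cvgrPdist_lt => e e0; near=> y.
  rewrite /pospow max_r ?powR0 ?gt_eqF ?subrr ?normr0//.
  by rewrite ltW//; near: y; exact: lt_nbhsl.
- apply: differentiable_continuous; apply/derivable1_diffP.
  by have [] := is_derive_pospow p x0.
- rewrite /continuous_at (_ : pospow p 0 = 0); last first.
    by rewrite /pospow maxxx powR0 ?gt_eqF.
  apply/cvgrPdist_lt => e e0; near=> y.
  rewrite sub0r normrN ger0_norm ?powR_ge0//.
  rewrite -[ltRHS](powRr1 (ltW e0)) -(mulVf (lt0r_neq0 p0)) powRrM.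
  rewrite gt0_ltr_powR// ?nnegrE ?powR_ge0// ?le_max ?lexx ?orbT//.
  rewrite gt_max powR_gt0// andbT (le_lt_trans (ler_norm _))//.
  near: y; exists (e `^ p^-1) => /=; first exact: powR_gt0.
  by move=> z /=; rewrite sub0r normrN.
Unshelve. all: by end_near. Qed.

(** The mean value theorem is applied to [pospow], continuous at 0, so that [x = 0], the first mesh
    cell, is included. *)
Lemma powR_diff_bounds p x y : 1 <= p -> 0 <= x -> x < y ->
  p * x `^ (p - 1) * (y - x) <= y `^ p - x `^ p <= p * y `^ (p - 1) * (y - x).
Proof.
move=> p1 x0 xy; have p0 : 0 < p by rewrite (lt_le_trans ltr01).
have [| |c] := @MVT R (pospow p) (fun z => p * z `^ (p - 1)) x y xy.
- move=> z; rewrite in_itv/= => /andP[xz _].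
  by apply: is_derive_pospow; exact: le_lt_trans xz.
- exact/continuous_subspaceT/continuous_pospow.
rewrite in_itv/= => /andP[xc cy]; rewrite !pospowE// ?(le_trans x0 (ltW xy))// => ->.
have yx : 0 <= y - x by rewrite subr_ge0 ltW.
have c0 : 0 <= c by rewrite (le_trans x0)// ltW.
by rewrite !ler_wpM2r// ler_wpM2l ?(ltW p0)// ge0_ler_powR ?subr_ge0// ?nnegrE//
  ?ltW// (le_lt_trans c0).
Qed.

(** Follows from [x^p <= y^(p-1) x]. Compared with the mean value bound it loses the factor [p] but
    has the power at the right endpoint, so it does not degenerate on the first mesh cell, where
    [x = 0]. *)
Lemma powR_diff_ge p x y : 1 <= p -> 0 <= x -> x <= y ->
  y `^ (p - 1) * (y - x) <= y `^ p - x `^ p.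
Proof.
move=> p1 x0 xy; have y0 : 0 <= y by exact: le_trans xy.
have E z : 0 <= z -> z `^ p = z `^ (p - 1) * z.
  move=> z0; have [->|z1] := eqVneq z 0.
    by rewrite mulr0 powR0// gt_eqF// (lt_le_trans ltr01).
  rewrite -{3}[z]powRr1// -powRD ?subrK//.
  by rewrite z1 implybT.
by rewrite mulrBr -E// lerD2l lerN2 E// ler_wpM2r// ge0_ler_powR ?subr_ge0.
Qed.

End positive_power.

(** * Nonincreasing kernels and their primitives *)

Section convolution_kernel.
Context {R : realType}.
Notation mu := (@lebesgue_measure R).
Variables g P : R -> R.
Hypothesis P_cont : continuous P.
Hypothesis P_deriv : forall x : R, 0 < x -> is_derive x (1 : R) P (g x).
Hypothesis g_ge0 : forall x : R, 0 < x -> 0 <= g x.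
Hypothesis g_cont : forall x : R, 0 < x -> {for x, continuous g}.
Hypothesis g_dec : forall x y : R, 0 < x -> x <= y -> g y <= g x.

Lemma continuous_shift (h : R -> R) (t : R) :
  continuous h -> continuous (fun y => h (y - t)).
Proof.
move=> hc x; apply: (@continuous_comp _ _ _ (fun y => y - t) h); last exact: hc.
by apply: cvgB; [exact: cvg_id|exact: cvg_cst].
Qed.

(** The case [b = t] covers the diagonal cell: the kernel may be singular at 0, where only its
    primitive is continuous. *)
Lemma kernel_inner_integral (a b t : R) : a <= b -> b <= t ->
  \int[mu]_(y in `[a, b]) g (t - y) = P (t - a) - P (t - b).
Proof.
move=> ab bt; rewrite /Rintegral.
rewrite (@ge0_FTC2_cc _ (fun y => g (t - y)) (fun y => - P (t - y)))//.
- by rewrite -EFinB/= opprK addrC.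
- move=> y; rewrite in_itv/= => /andP[_ yb].
  by apply: g_ge0; rewrite subr_gt0 (lt_le_trans yb).
- move=> y; rewrite in_itv/= => /andP[_ yb].
  apply: (@continuous_comp _ _ _ (fun y => t - y) g).
    by apply: cvgB; [exact: cvg_cst|exact: cvg_id].
  by apply: g_cont; rewrite subr_gt0 (lt_le_trans yb).
- move=> y; rewrite in_itv/= => /andP[_ yb].
  have ty : 0 < t - y by rewrite subr_gt0 (lt_le_trans yb).
  have dP := P_deriv ty.
  have dt : is_derive y (1 : R) (fun y => t - y) (- 1).
    by rewrite -[X in is_derive _ _ _ X]sub0r; exact: is_deriveB.
  have := is_deriveN (@is_derive1_comp _ P (fun y => t - y) y _ _ dP dt).
  by rewrite mulrN1 opprK.
- move=> y; apply: cvgN; apply: (@continuous_comp _ _ _ (fun y => t - y) P).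
    by apply: cvgB; [exact: cvg_cst|exact: cvg_id].
  exact: P_cont.
Qed.

Lemma kernel_primitive_ge (x y : R) : 0 <= x -> x <= y ->
  g y * (y - x) <= P y - P x.
Proof.
move=> x0; rewrite le_eqVlt => /predU1P[->|xy]; first by rewrite !subrr mulr0.
have [| |c] := @MVT R P g x y xy.
- by move=> z; rewrite in_itv/= => /andP[xz _]; apply: P_deriv; exact: le_lt_trans xz.
- exact: continuous_subspaceT.
rewrite in_itv/= => /andP[xc cy] ->; rewrite ler_wpM2r ?subr_ge0 ?(ltW xy)//.
by rewrite g_dec ?(ltW cy)// (le_lt_trans x0).
Qed.

Lemma kernel_primitive_le (x y : R) : 0 < x -> x <= y ->
  P y - P x <= g x * (y - x).
Proof.
move=> x0; rewrite le_eqVlt => /predU1P[->|xy]; first by rewrite !subrr mulr0.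
have [| |c] := @MVT R P g x y xy.
- by move=> z; rewrite in_itv/= => /andP[xz _]; apply: P_deriv; exact: lt_trans xz.
- exact: continuous_subspaceT.
rewrite in_itv/= => /andP[xc cy] ->; rewrite ler_wpM2r ?subr_ge0 ?(ltW xy)//.
by rewrite g_dec// ltW.
Qed.

Lemma kernel_primitive_nd (x y : R) : 0 <= x -> x <= y -> P x <= P y.
Proof.
move=> x0; rewrite le_eqVlt => /predU1P[->//|xy].
rewrite -subr_ge0 (le_trans _ (kernel_primitive_ge x0 (ltW xy)))//.
by rewrite mulr_ge0 ?subr_ge0 ?(ltW xy)// g_ge0// (le_lt_trans x0).
Qed.

End convolution_kernel.

Section exponential_sum.
Context {R : realType}.
Variables (N : nat) (w s : 'I_N -> R).
Hypothesis ws_gt0 : forall l, 0 < w l /\ 0 < s l.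

Definition soe_primitive (x : R) : R :=
  \sum_(l < N) - (w l / s l) * expR (- s l * x).

Lemma is_derive_soe_primitive (x : R) :
  is_derive x (1 : R) soe_primitive (soe w s x).
Proof.
pose F l x := - (w l / s l) * expR (- s l * x) : R.
have dF l : is_derive x (1 : R) (F l) (w l * expR (- s l * x)).
  have dm : is_derive x (1 : R) (fun y => - s l * y) (- s l).
    by rewrite -[X in is_derive _ _ _ X]mulr1; exact: is_deriveZ.
  have := is_deriveZ (- (w l / s l)) (@is_derive1_comp _ expR
    (fun y => - s l * y) x _ _ (is_derive_expR (- s l * x)) dm).
  rewrite (_ : _ *: _ = w l * expR (- s l * x))//.
  rewrite -[LHS]/(- (w l / s l) * (expR (- s l * x) * - s l)).
  by field; rewrite gt_eqF// (ws_gt0 l).2.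
rewrite (_ : soe_primitive = \sum_(l < N) F l); last first.
  by apply/funext => y; rewrite fct_sumE.
exact: is_derive_sum.
Qed.

Lemma soe_ge0 (x : R) : 0 <= soe w s x.
Proof.
by apply: sumr_ge0 => l _; rewrite mulr_ge0 ?expR_ge0// ltW// (ws_gt0 l).1.
Qed.

Lemma soe_nonincreasing (x y : R) : x <= y -> soe w s y <= soe w s x.
Proof.
move=> xy; apply: ler_sum => l _; have [w0 s0] := ws_gt0 l.
by rewrite ler_pM2l// ler_expR ler_nM2l// oppr_lt0.
Qed.

Lemma continuous_soe_primitive : continuous soe_primitive.
Proof.
move=> x; apply: differentiable_continuous; apply/derivable1_diffP.
by have [] := is_derive_soe_primitive x.
Qed.

Lemma continuous_soe : continuous (soe w s).
Proof.
apply: continuous_big => [|l _ x]; first exact: add_continuous.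
apply: cvgM; first exact: cvg_cst.
apply: (@continuous_comp _ _ _ (fun y => - s l * y) expR).
  by apply: cvgM; [exact: cvg_cst|exact: cvg_id].
exact: continuous_expR.
Qed.

End exponential_sum.

(** * The Gamma integral and half of its functional equation *)

Section gamma_function.
Context {R : realType}.
Notation mu := (@lebesgue_measure R).

(** Extended-valued, so that inequalities between two such integrals make sense before their
    convergence is known; [Gamma] is its [fine]. *)
Definition gamma_integral (x : R) : \bar R :=
  (\int[mu]_(t in `]0%R, +oo[) (t `^ (x - 1) * expR (- t))%:E)%E.

Lemma continuous_gamma_integrand (p t : R) : 0 < t ->
  {for t, continuous (fun t : R => t `^ p * expR (- t))}.
Proof.
move=> t0.
have cp : {for t, continuous (@powR R ^~ p)}.
  apply: differentiable_continuous; apply/derivable1_diffP.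
  by have [] := is_derive_powR p t0.
apply: cvgM; first exact: cp.
apply: (@continuous_comp _ _ _ -%R expR); last exact: continuous_expR.
exact: opp_continuous.
Qed.

Lemma gamma_integrand_ge0 (p t : R) : 0 <= t `^ p * expR (- t).
Proof. by rewrite mulr_ge0 ?powR_ge0 ?expR_ge0. Qed.

Lemma measurable_gamma_integrand (p : R) :
  measurable_fun `]0 : R, +oo[ (fun t : R => t `^ p * expR (- t)).
Proof.
apply: open_continuous_measurable_fun => // t.
by rewrite inE/= in_itv/= andbT; exact: continuous_gamma_integrand.
Qed.

(** Integration by parts: the boundary term at [b] is dropped for its sign, the one at [a] is at
    most [a^p], which tends to 0 with [a]. *)
Lemma gamma_by_parts (p a b : R) : 0 < p -> 0 < a -> a < b ->
  (\int[mu]_(t in `[a, b]) (t `^ p * expR (- t))%:E <=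
   p%:E * gamma_integral p + (a `^ p)%:E)%E.
Proof.
move=> p0 a0 ab.
pose u (t : R) := t `^ p * expR (- t).
pose h (t : R) := t `^ (p - 1) * expR (- t).
have pos t : t \in `[a, b] -> 0 < t.
  by rewrite in_itv/= => /andP[+ _]; exact: lt_le_trans.
have cont (q : R) : {within `[a, b], continuous (fun t : R => t `^ q * expR (- t))}.
  apply: continuous_in_subspaceT => t /[!inE] /pos.
  exact: continuous_gamma_integrand.
have iu : mu.-integrable `[a, b] (EFin \o u).
  apply: continuous_compact_integrable; first exact: segment_compact.
  exact: cont.
have ih : mu.-integrable `[a, b] (EFin \o h).
  apply: continuous_compact_integrable; first exact: segment_compact.
  exact: cont.
have iph : mu.-integrable `[a, b] (EFin \o (fun t => p * h t)).
  rewrite (_ : EFin \o _ = fun t => p%:E * (h t)%:E)%E//.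
  exact: integrableZl.
have du (t : R) : 0 < t -> is_derive t (1 : R) u (p * h t - u t).
  move=> t0.
  have dp := is_derive_powR p t0.
  have de := @is_derive1_comp _ expR -%R t _ _ (is_derive_expR (- t)) (is_deriveNid t 1).
  have := is_deriveM dp de.
  rewrite (_ : _ + _ = p * h t - u t)//.
  rewrite -[_ *: (_ * _)]/(t `^ p * (expR (- t) * - 1)).
  rewrite -[_ *: (p * _)]/(expR (- t) * (p * t `^ (p - 1))) /h /u; ring.
have FTC : (\int[mu]_(t in `[a, b]) (p * h t - u t)%:E = (u b)%:E - (u a)%:E)%E.
  apply: continuous_FTC2 => //.
  - apply: continuous_in_subspaceT => t /[!inE] /pos t0.
    apply: cvgB; last exact: continuous_gamma_integrand.
    by apply: cvgM; [exact: cvg_cst|exact: continuous_gamma_integrand].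
  - have cu t : 0 < t -> {for t, continuous u} by exact: continuous_gamma_integrand.
    split=> [t tab| |].
    + by have /pos/du[] : t \in `[a, b] by apply: subset_itv_oo_cc tab.
    + by apply: cvg_at_right_filter; exact: cu.
    + by apply: cvg_at_left_filter; apply: cu; exact: lt_trans ab.
  - move=> t tab; rewrite derive1E.
    have /pos/du dt : t \in `[a, b] by apply: subset_itv_oo_cc tab.
    exact: derive_val.
have E1 : (\int[mu]_(t in `[a, b]) (u t)%:E =
    \int[mu]_(t in `[a, b]) (p * h t)%:E - ((u b)%:E - (u a)%:E))%E.
  rewrite -FTC (_ : (\int[mu]_(t in _) (p * h t - u t)%:E =
    \int[mu]_(t in `[a, b]) (p * h t)%:E - \int[mu]_(t in `[a, b]) (u t)%:E)%E);
    last exact: (integralB_EFin _ iph iu).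
  have [x ->] : exists x : R, (\int[mu]_(t in `[a, b]) (p * h t)%:E = x%:E)%E.
    exists (fine (\int[mu]_(t in `[a, b]) (p * h t)%:E)%E).
    by rewrite fineK// integrable_fin_num.
  have [y ->] : exists y : R, (\int[mu]_(t in `[a, b]) (u t)%:E = y%:E)%E.
    exists (fine (\int[mu]_(t in `[a, b]) (u t)%:E)%E).
    by rewrite fineK// integrable_fin_num.
  by rewrite -!EFinB; congr EFin; lra.
rewrite E1 leeD//.
  under eq_integral do rewrite EFinM.
  rewrite integralZl// lee_pmul2l ?lte_fin//.
  apply: ge0_subset_integral => //.
  - by apply/measurable_EFinP; exact: measurable_gamma_integrand.
  - by move=> t _; rewrite lee_fin gamma_integrand_ge0.
  - by move=> t /= tab; rewrite in_itv/= andbT pos.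
rewrite -EFinB -EFinN lee_fin opprB lerBlDr.
rewrite (@le_trans _ _ (a `^ p))//.
  rewrite /u ler_piMr ?powR_ge0// -expR0 ler_expR oppr_le0 ltW//.
by rewrite lerDl gamma_integrand_ge0.
Qed.

Lemma gamma_integral_le (p : R) : 0 < p ->
  (gamma_integral (p + 1) <= p%:E * gamma_integral p)%E.
Proof.
move=> p0; rewrite {1}/gamma_integral addrK.
pose A (n : nat) : set R := [set` `[n.+2%:R^-1, n.+2%:R]].
have UA : [set` `]0%R, +oo[] = \bigcup_n A n.
  apply/seteqP; split=> [t|t [n _]] /=; last first.
    rewrite /A/= !in_itv/= andbT => /andP[+ _].
    by apply: lt_le_trans; rewrite invr_gt0.
  rewrite in_itv/= andbT => t0.
  have [n nt] : exists n : nat, t + t^-1 < n%:R.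
    exists (Num.truncn (t + t^-1)).+1; exact: truncnS_gt.
  exists n => //; rewrite /A/= in_itv/=.
  have tV : 0 < t^-1 by rewrite invr_gt0.
  have n2 : n.+2%:R = n%:R + 2 :> R by rewrite -addn2 natrD.
  apply/andP; split; last by rewrite n2; lra.
  rewrite -[leRHS]invrK lef_pV2 ?posrE// n2; lra.
have cvA : (\int[mu]_(t in A n) (t `^ p * expR (- t))%:E)%E @[n --> \oo] -->
    (\int[mu]_(t in `]0%R, +oo[) (t `^ p * expR (- t))%:E)%E.
  rewrite UA; apply: ge0_nondecreasing_set_cvg_integral.
  - move=> n k nk; rewrite subsetEset => t; rewrite /A/= !in_itv/= => /andP[h1 h2].
    rewrite (le_trans _ h1) ?(le_trans h2) ?ler_nat ?lef_pV2 ?posrE ?ler_nat//.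
  - by move=> n; exact: measurable_itv.
  - move=> n; apply/measurable_EFinP; apply: measurable_funS (measurable_gamma_integrand p) => //.
    by rewrite UA; exact: bigcup_sup.
  - by move=> n t _; rewrite lee_fin gamma_integrand_ge0.
have cvB : (p%:E * gamma_integral p + (n.+2%:R^-1 `^ p)%:E)%E @[n --> \oo] -->
    (p%:E * gamma_integral p)%E.
  rewrite -[X in _ --> X]adde0; apply: cvgeD.
  - by rewrite fin_num_adde_defl.
  - exact: cvg_cst.
  apply: cvg_EFin; first exact: nearW.
  have := continuous_pospow p0 (x := 0).
  rewrite /continuous_at {2}/pospow maxxx powR0 ?gt_eqF// => c0.
  rewrite (_ : fine \o _ = fun n => pospow p (n.+2%:R^-1)); last first.
    by apply/funext => n /=; rewrite pospowE// invr_ge0.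
  apply: (cvg_comp _ _ _ c0).
  have := @cvg_harmonic R; rewrite -(cvg_shiftn 1); apply: cvg_trans.
  by apply: near_eq_cvg; near=> n; rewrite /= addn1.
rewrite -(cvg_lim _ cvA)// -(cvg_lim _ cvB)//.
apply: lee_lim.
- by apply/cvg_ex; eexists; exact: cvA.
- by apply/cvg_ex; eexists; exact: cvB.
apply: nearW => n; apply: gamma_by_parts => //.
by rewrite (@lt_trans _ _ 1)// ?ltr1n// invf_lt1// ltr1n.
Unshelve. all: by end_near. Qed.

Lemma gamma_integral_gt0 (x : R) : 1 <= x -> (0 < gamma_integral x)%E.
Proof.
move=> x1; apply: (@lt_le_trans _ _ (\int[mu]_(t in `[1%R, 2%R]) (expR (- 2))%:E)%E).
  rewrite integral_cst//= lebesgue_measure_itv/= lte_fin ltr1n/= -EFinB.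
  by rewrite (_ : 2 - 1 = 1)%R ?mule1 ?lte_fin ?expR_gt0//; lra.
apply: (@le_trans _ _ (\int[mu]_(t in `[1%R, 2%R]) (t `^ (x - 1) * expR (- t))%:E)%E).
  apply: ge0_le_integral => //.
  - apply/measurable_EFinP; apply: measurable_funS (measurable_gamma_integrand _) => //.
    by move=> t /=; rewrite !in_itv/= andbT => /andP[+ _]; exact: lt_le_trans.
  - move=> t /=; rewrite in_itv/= => /andP[t1 t2]; rewrite lee_fin.
    rewrite -[leLHS]mul1r ler_pM ?expR_ge0//; last by rewrite ler_expR lerN2.
    apply: (@le_trans _ _ (1 `^ (x - 1))); first by rewrite powR1.
    by rewrite ge0_ler_powR ?subr_ge0// nnegrE// (le_trans _ t1).
apply: ge0_subset_integral => //.
- by apply/measurable_EFinP; exact: measurable_gamma_integrand.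
- by move=> t _; rewrite lee_fin gamma_integrand_ge0.
- by move=> t /=; rewrite !in_itv/= andbT => /andP[+ _]; exact: lt_le_trans.
Qed.

Lemma GammaE (x : R) : Gamma x = fine (gamma_integral x).
Proof. by []. Qed.

Lemma Gamma_ge0 (x : R) : 0 <= Gamma x.
Proof. by apply: Rintegral_ge0 => t _; exact: gamma_integrand_ge0. Qed.

(* [Gamma x] is 0 when the integral diverges, so [Gamma x != 0] carries its
   convergence. *)
Lemma Gamma_add2_bounds (x : R) : 0 < x -> Gamma x != 0 ->
  0 < Gamma (x + 2) <= (x + 1) * x * Gamma x.
Proof.
move=> x0 Gx.
have finx : gamma_integral x \is a fin_num.
  by move: Gx; rewrite GammaE; case: (gamma_integral x) => //=; rewrite eqxx.
have le2 : (gamma_integral (x + 2) <= ((x + 1) * x * Gamma x)%:E)%E.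
  rewrite (_ : x + 2 = x + 1 + 1); last by ring.
  rewrite (le_trans (gamma_integral_le _)) ?addr_gt0//.
  by rewrite -mulrA EFinM lee_pmul2l ?lte_fin ?addr_gt0// EFinM GammaE fineK// gamma_integral_le.
have gt2 : (0 < gamma_integral (x + 2))%E by apply: gamma_integral_gt0; lra.
have fin2 : gamma_integral (x + 2) \is a fin_num.
  by rewrite ge0_fin_numE ?(ltW gt2)// (le_lt_trans le2)// ltry.
by rewrite GammaE -lte_fin -lee_fin fineK// gt2 le2.
Qed.

End gamma_function.

(** * Step sizes of the graded mesh *)

Section graded_mesh.
Context {R : realType}.
Variables (r T : R) (M : nat).
Hypotheses (r1 : 1 <= r) (T0 : 0 < T) (M0 : (1 <= M)%N).

Local Notation t_ := (tmesh r T M).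
Local Notation tau_ := (tau r T M).

Let r0 : 0 < r. Proof. exact: lt_le_trans r1. Qed.
Let MR0 : 0 < M%:R :> R. Proof. by rewrite ltr0n. Qed.

Let pdiff (n : nat) : R := n%:R `^ r - n.-1%:R `^ r.

Let scale : R := T * M%:R^-1 `^ r.

Let scale_gt0 : 0 < scale.
Proof. by rewrite mulr_gt0// powR_gt0// invr_gt0. Qed.

Let tmeshE n : t_ n = scale * n%:R `^ r.
Proof. by rewrite /tmesh powRM ?invr_ge0// /scale mulrAC mulrA. Qed.

Let tauE n : tau_ n = scale * pdiff n.
Proof. by rewrite /tau !tmeshE mulrBr. Qed.

Let pdiff_bounds n : r * n%:R `^ (r - 1) <= pdiff n.+1 <= r * n.+1%:R `^ (r - 1).
Proof.
have := @powR_diff_bounds R r n%:R n.+1%:R r1 (ler0n _ _).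
rewrite ltr_nat ltnSn => /(_ isT).
by rewrite -natr1 addrAC subrr add0r !mulr1 natr1.
Qed.

Lemma tmesh0 : t_ 0%N = 0.
Proof. by rewrite tmeshE powR0 ?mulr0// gt_eqF. Qed.

Lemma tmesh_le n : (n <= M)%N -> t_ n <= T.
Proof.
move=> nM; rewrite /tmesh ler_piMr ?(ltW T0)//.
apply: (@le_trans _ _ (1 `^ r)); last by rewrite powR1.
rewrite ge0_ler_powR ?nnegrE ?divr_ge0 ?(ltW r0)//.
by rewrite ler_pdivrMr// mul1r ler_nat.
Qed.

Lemma tau_gt0 n : (1 <= n)%N -> 0 < tau_ n.
Proof.
case: n => // n _; rewrite tauE mulr_gt0// subr_gt0/=.
by rewrite gt0_ltr_powR ?nnegrE// ltr_nat.
Qed.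

(** Up to [scale], the number [r n^(r-1)] is an upper bound for step [n] and a lower bound for step
    [n + 1]. *)
Lemma tauS_le n : (1 <= n)%N -> tau_ n <= tau_ n.+1.
Proof.
case: n => // n _; rewrite !tauE ler_pM2l//.
have /andP[_ h1] := pdiff_bounds n; have /andP[h2 _] := pdiff_bounds n.+1.
exact: le_trans h1 h2.
Qed.

Lemma tau_mono m n : (1 <= m)%N -> (m <= n)%N -> tau_ m <= tau_ n.
Proof.
move=> m1; elim: n => [|n IHn]; first by rewrite leqn0 => /eqP ->.
rewrite leq_eqVlt => /predU1P[->//|mn].
by rewrite (le_trans (IHn mn))// tauS_le// (leq_trans m1).
Qed.

Lemma tmesh_nd m n : (m <= n)%N -> t_ m <= t_ n.
Proof.
by move=> mn; rewrite !tmeshE ler_pM2l// ge0_ler_powR ?nnegrE ?(ltW r0)// ler_nat.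
Qed.

Lemma tmesh_lt m n : (m < n)%N -> t_ m < t_ n.
Proof.
by move=> mn; rewrite !tmeshE ltr_pM2l// gt0_ltr_powR ?nnegrE// ltr_nat.
Qed.

Lemma tau_le n : (1 <= n <= M)%N -> tau_ n <= r * T / M%:R.
Proof.
case: n => // n /andP[_ nM]; rewrite tauE.
have /andP[_ h] := pdiff_bounds n.
rewrite (@le_trans _ _ (scale * (r * M%:R `^ (r - 1))))//.
  rewrite ler_pM2l// (le_trans h)// ler_pM2l// ge0_ler_powR ?nnegrE ?subr_ge0//.
  by rewrite ler_nat.
have E : M%:R^-1 `^ r * M%:R `^ (r - 1) = M%:R^-1 :> R.
  rewrite -[in LHS](powR_inv1 (ltW MR0)) -powRrM mulN1r -powRD; last first.
    by apply/implyP => _; rewrite gt_eqF.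
  by rewrite addrA addNr add0r powR_inv1// ltW.
suff -> : scale * (r * M%:R `^ (r - 1)) = r * T / M%:R by [].
by rewrite -[in RHS]E /scale; ring.
Qed.

(** The 3 is the largest value of [(n + 2) / n], reached at [n = 1]. The factor [r] comes from the
    mean value bound on the longer step; the shorter one is bounded below by [powR_diff_ge]. *)
Lemma tau_ratio n : (1 <= n)%N -> tau_ n.+2 <= r * 3 `^ (r - 1) * tau_ n.
Proof.
case: n => // n _; rewrite !tauE mulrCA ler_pM2l//.
have /andP[_ h] := pdiff_bounds n.+2.
rewrite (le_trans h)// -mulrA ler_pM2l//.
rewrite (@le_trans _ _ (3 `^ (r - 1) * n.+1%:R `^ (r - 1)))//.
  rewrite -powRM// ge0_ler_powR ?subr_ge0 ?nnegrE ?mulr_ge0//.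
  by rewrite -natrM ler_nat mulSn !mulSn mul0n addn0 !addSn !addnS !ltnS leq_addr.
rewrite ler_wpM2l ?powR_ge0//.
have := @powR_diff_ge R r n%:R n.+1%:R r1 (ler0n _ _).
rewrite ler_nat leqnSn => /(_ isT).
by rewrite -natr1 addrAC subrr add0r !mulr1 natr1.
Qed.

End graded_mesh.

Section power_kernel.
Context {R : realType}.
Variable alpha : R.
Hypothesis halpha : 0 < alpha < 1.

Let be0 : 0 < 1 - alpha. Proof. by case/andP: halpha => _; rewrite subr_gt0. Qed.

Definition pow_primitive (x : R) : R := (1 - alpha)^-1 * pospow (1 - alpha) x.

Lemma continuous_pow_primitive : continuous pow_primitive.
Proof.
by move=> x; apply: cvgM; [exact: cvg_cst|exact: continuous_pospow].
Qed.

Lemma is_derive_pow_primitive (x : R) : 0 < x ->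
  is_derive x (1 : R) pow_primitive (x `^ (- alpha)).
Proof.
move=> x0; have := is_deriveZ (1 - alpha)^-1 (is_derive_pospow (1 - alpha) x0).
rewrite (_ : _ *: _ = x `^ (- alpha))//.
rewrite -[LHS]/((1 - alpha)^-1 * ((1 - alpha) * x `^ (1 - alpha - 1))).
by rewrite mulKf ?gt_eqF// addrAC subrr add0r.
Qed.

Lemma pow_kernel_ge0 (x : R) : 0 < x -> 0 <= x `^ (- alpha).
Proof. by rewrite powR_ge0. Qed.

Lemma continuous_pow_kernel (x : R) : 0 < x ->
  {for x, continuous (fun x : R => x `^ (- alpha))}.
Proof.
move=> x0; apply: differentiable_continuous; apply/derivable1_diffP.
by have [] := is_derive_powR (- alpha) x0.
Qed.

Lemma pow_kernel_dec (x y : R) : 0 < x -> x <= y ->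
  y `^ (- alpha) <= x `^ (- alpha).
Proof.
move=> x0 xy; have y0 : 0 < y by exact: lt_le_trans xy.
rewrite !powRN lef_pV2 ?posrE ?powR_gt0//.
have [a0 _] := andP halpha.
by rewrite ge0_ler_powR ?nnegrE ?(ltW a0) ?(ltW x0) ?(ltW y0).
Qed.

Definition pow_primitive2 (x : R) : R :=
  ((1 - alpha) * (2 - alpha))^-1 * pospow (2 - alpha) x.

Let be1 : 0 < 2 - alpha. Proof. by have := be0; lra. Qed.

Lemma continuous_pow_primitive2 : continuous pow_primitive2.
Proof.
by move=> x; apply: cvgM; [exact: cvg_cst|exact: continuous_pospow].
Qed.

Lemma is_derive_pow_primitive2 (x : R) : 0 < x ->
  is_derive x (1 : R) pow_primitive2 (pow_primitive x).
Proof.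
move=> x0; have := is_deriveZ ((1 - alpha) * (2 - alpha))^-1 (is_derive_pospow (2 - alpha) x0).
rewrite (_ : _ *: _ = pow_primitive x)//.
rewrite -[LHS]/(((1 - alpha) * (2 - alpha))^-1 * ((2 - alpha) * x `^ (2 - alpha - 1))).
rewrite /pow_primitive pospowE ?(ltW x0)// (_ : 2 - alpha - 1 = 1 - alpha); last by ring.
by field; rewrite !gt_eqF.
Qed.

Lemma pow_primitive_ge0 (x : R) : 0 <= pow_primitive x.
Proof. by rewrite mulr_ge0 ?powR_ge0 ?invr_ge0 ?ltW. Qed.

Lemma pow_primitive2_ge0 (x : R) : 0 <= pow_primitive2 x.
Proof. by rewrite mulr_ge0 ?powR_ge0 ?invr_ge0 ?mulr_ge0 ?ltW. Qed.

Lemma pow_primitive_nd (x y : R) : 0 <= x -> x <= y ->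
  pow_primitive x <= pow_primitive y.
Proof.
apply: (@kernel_primitive_nd _ (fun x => x `^ (- alpha))).
- exact: continuous_pow_primitive.
- exact: is_derive_pow_primitive.
- exact: pow_kernel_ge0.
- exact: pow_kernel_dec.
Qed.

Lemma pow_primitive0 : pow_primitive 0 = 0.
Proof. by rewrite /pow_primitive pospowE// powR0 ?mulr0// gt_eqF. Qed.

Lemma pow_primitive20 : pow_primitive2 0 = 0.
Proof. by rewrite /pow_primitive2 pospowE// powR0 ?mulr0// gt_eqF. Qed.

Lemma pow_primitive_integral (a c d : R) : a <= c -> c <= d ->
  \int[lebesgue_measure]_(t in `[c, d]) pow_primitive (t - a) =
  pow_primitive2 (d - a) - pow_primitive2 (c - a).
Proof.
move=> ac cd; rewrite /Rintegral.
rewrite (@ge0_FTC2_cc _ (fun t => pow_primitive (t - a)) (fun t => pow_primitive2 (t - a)))//.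
- by move=> t _; exact: pow_primitive_ge0.
- by move=> t _; exact: continuous_shift continuous_pow_primitive t.
- move=> t; rewrite in_itv/= => /andP[ct _].
  have ta : 0 < t - a by rewrite subr_gt0 (le_lt_trans ac).
  have dt : is_derive t (1 : R) (fun y => y - a) 1.
    by rewrite -[X in is_derive _ _ _ X]subr0; exact: is_deriveB.
  have := @is_derive1_comp _ pow_primitive2 (fun y => y - a) t _ _ (is_derive_pow_primitive2 ta) dt.
  by rewrite mulr1.
- exact: continuous_shift continuous_pow_primitive2.
Qed.

End power_kernel.

(** * Coefficients of the fast averaged L1 operator *)

Lemma ler_wpM2l_div (R : numFieldType) (c a b x y : R) :
  0 <= c -> a / x <= b / y -> c * a / x <= c * b / y.
Proof. by move=> c0 ab; rewrite -!mulrA ler_wpM2l. Qed.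

Lemma ler_Rintegral_div (R : realType) (A B : R -> R) (c d x y : R) :
  continuous A -> continuous B ->
  (forall t, c <= t <= d -> A t / x <= B t / y) ->
  \int[lebesgue_measure]_(t in `[c, d]) A t / x <=
  \int[lebesgue_measure]_(t in `[c, d]) B t / y.
Proof.
move=> cA cB AB.
have int (F : R -> R) (z : R) : continuous F ->
    (@lebesgue_measure R).-integrable `[c, d] (EFin \o (fun t => F t / z)).
  move=> cF; apply: continuous_compact_integrable; first exact: segment_compact.
  apply: continuous_subspaceT => t.
  by apply: cvgM; [exact: cF|exact: cvg_cst].
have int1 (F : R -> R) : continuous F ->
    (@lebesgue_measure R).-integrable `[c, d] (EFin \o F).
  move=> cF; apply: continuous_compact_integrable; first exact: segment_compact.
  exact: continuous_subspaceT.
rewrite -(RintegralZr x^-1 _ (int1 _ cA))// -(RintegralZr y^-1 _ (int1 _ cB))//.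
apply: le_Rintegral => //; first exact: int.
  exact: int.
Qed.

(* The constant comes from the mean value theorem on the graded mesh: the
   distance from [t] to the last history cell is at most [4 r 3^(r-1)] times
   half the length of that cell. *)
Definition soe_const (R : realType) (alpha r : R) : R :=
  (2 * r) `^ (- alpha) * (1 - (1 + (4 * (r * 3 `^ (r - 1)))^-1) `^ (- alpha)) / 2.

Section fast_coefficients.
Context {R : realType}.
Variables (alpha r T : R) (M : nat) (N : nat) (w s : 'I_N -> R) (eps : R).
Hypothesis halpha : 0 < alpha < 1.
Hypothesis r1 : 1 <= r.
Hypothesis T0 : 0 < T.
Hypothesis M1 : (1 <= M)%N.
Hypothesis soew : soe_approx alpha r T M w s eps.

Local Notation t_ := (tmesh r T M).
Local Notation tau_ := (tau r T M).
Local Notation a_ := (fast_coef alpha r T M w s).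

Let ws := soew.1.

Lemma fast_coef_ge0 n k : (1 <= n)%N -> 0 <= a_ n k.
Proof.
move=> n1; rewrite /fast_coef mulr_ge0//.
  by rewrite invr_ge0 mulr_ge0 ?Gamma_ge0// ltW// tau_gt0.
case: ifP => _; apply: Rintegral_ge0 => t _; apply: Rintegral_ge0 => y _.
  exact: soe_ge0.
exact: powR_ge0.
Qed.

Let P := soe_primitive w s.
Let Q := pow_primitive alpha.

Lemma fast_coef_far n k : (1 <= k)%N -> (k.+2 <= n)%N ->
  a_ n k = (tau_ n * Gamma (1 - alpha))^-1 *
    \int[lebesgue_measure]_(t in `[t_ n.-1, t_ n]) (P (t - t_ k.-1) - P (t - t_ k)).
Proof.
move=> k1 kn; rewrite /fast_coef kn; congr (_ * _).
apply: eq_Rintegral => t; rewrite inE/= in_itv/= => /andP[tn _].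
apply: kernel_inner_integral.
- exact: continuous_soe_primitive.
- by move=> x _; exact: is_derive_soe_primitive.
- by move=> x _; exact: soe_ge0.
- by move=> x _; exact: continuous_soe.
- by apply: tmesh_nd => //; exact: leq_pred.
- by apply: le_trans tn; apply: tmesh_nd => //; rewrite -ltnS prednK// ltnW// (leq_trans _ kn).
Qed.

Let pow_inner (a b t : R) : a <= b -> b <= t ->
  \int[lebesgue_measure]_(y in `[a, b]) (t - y) `^ (- alpha) = Q (t - a) - Q (t - b).
Proof.
apply: (@kernel_inner_integral _ (fun x => x `^ (- alpha))).
- exact: continuous_pow_primitive.
- exact: is_derive_pow_primitive.
- exact: pow_kernel_ge0.
- exact: continuous_pow_kernel.
Qed.

Lemma fast_coef_near n :
  a_ n.+2 n.+1 = (tau_ n.+2 * Gamma (1 - alpha))^-1 *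
    \int[lebesgue_measure]_(t in `[t_ n.+1, t_ n.+2]) (Q (t - t_ n) - Q (t - t_ n.+1)).
Proof.
rewrite /fast_coef ltnn; congr (_ * _).
apply: eq_Rintegral => t; rewrite inE/= in_itv/= => /andP[tn _].
by rewrite min_r// pow_inner// tmesh_nd.
Qed.

Lemma fast_coef_diag n :
  a_ n.+1 n.+1 = (tau_ n.+1 * Gamma (1 - alpha))^-1 *
    \int[lebesgue_measure]_(t in `[t_ n, t_ n.+1]) Q (t - t_ n).
Proof.
rewrite /fast_coef ltnNge leqnSn/=; congr (_ * _).
apply: eq_Rintegral => t; rewrite inE/= in_itv/= => /andP[tn tn1].
by rewrite min_l// pow_inner// subrr /Q pow_primitive0 ?subr0.
Qed.

Let weight_ge0 n : (1 <= n)%N -> 0 <= (tau_ n * Gamma (1 - alpha))^-1.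
Proof. by move=> n1; rewrite invr_ge0 mulr_ge0 ?Gamma_ge0// ltW// tau_gt0. Qed.

Let cont_diff (F : R -> R) (a b : R) : continuous F ->
  continuous (fun t => F (t - a) - F (t - b)).
Proof. by move=> cF t; apply: cvgB; exact: continuous_shift. Qed.

(** For fixed [t], the two quotients are means of [soe] over adjacent cells; its value at the
    distance to their common node separates them. *)
Lemma fast_coef_far_mono n k : (1 <= k)%N -> (k.+3 <= n)%N ->
  a_ n k / tau_ k <= a_ n k.+1 / tau_ k.+1.
Proof.
move=> k1 kn.
have n1 : (1 <= n)%N by exact: leq_trans kn.
rewrite (fast_coef_far k1 (ltnW kn)) (fast_coef_far (ltn0Sn k) kn).
apply: ler_wpM2l_div; first exact: weight_ge0.
apply: ler_Rintegral_div.
- exact/cont_diff/continuous_soe_primitive.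
- exact/cont_diff/continuous_soe_primitive.
move=> t /andP[tn _] /=.
have tk1 : t_ k.+1 < t.
  apply: lt_le_trans tn; apply: tmesh_lt => //.
  by rewrite -ltnS prednK// (leq_trans _ kn).
have tk : t_ k < t by apply: lt_trans tk1; exact: tmesh_lt.
have kpos : 0 < tau_ k by exact: tau_gt0.
have k1pos : 0 < tau_ k.+1 by exact: tau_gt0.
apply: (@le_trans _ _ (soe w s (t - t_ k))).
  rewrite ler_pdivrMr//.
  rewrite (_ : tau_ k = (t - t_ k.-1) - (t - t_ k)); last by rewrite /tau; ring.
  apply: kernel_primitive_le.
  - exact: continuous_soe_primitive.
  - by move=> x _; exact: is_derive_soe_primitive.
  - by move=> x y _; exact: soe_nonincreasing.
  - by rewrite subr_gt0.
  - by rewrite lerD2l lerN2 tmesh_nd// leq_pred.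
rewrite ler_pdivlMr//.
rewrite (_ : tau_ k.+1 = (t - t_ k) - (t - t_ k.+1)); last by rewrite /tau/=; ring.
apply: kernel_primitive_ge.
- exact: continuous_soe_primitive.
- by move=> x _; exact: is_derive_soe_primitive.
- by move=> x y _; exact: soe_nonincreasing.
- by rewrite subr_ge0 ltW.
- by rewrite lerD2l lerN2 tmesh_nd.
Qed.

(** The two means are compared with [x^(-alpha)], [x] being the distance from [t] to the common
    node. Bounding [soe] on the whole farther cell by its value at [x] would leave the error [eps]
    uncompensated, so that cell is halved: the mean is at most half the sum of the values at [x] and
    [x + h / 2], and the decrease of the power between these points must cover [2 eps]. *)
Lemma fast_coef_last_mono n : (n.+3 <= M)%N ->
  eps <= soe_const alpha r * T `^ (- alpha) * M%:R `^ (- alpha) ->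
  a_ n.+3 n.+1 / tau_ n.+1 <= a_ n.+3 n.+2 / tau_ n.+2.
Proof.
move=> nM heps.
have [a0 a1] := andP halpha.
have r0 : 0 < r by exact: lt_le_trans r1.
rewrite fast_coef_near (fast_coef_far (ltn0Sn n) (leqnn n.+3)).
apply: ler_wpM2l_div; first exact: weight_ge0.
apply: ler_Rintegral_div.
- exact/cont_diff/continuous_soe_primitive.
- exact/cont_diff/continuous_pow_primitive.
move=> t /andP[/= tn tn3].
have h0 : 0 < tau_ n.+1 by exact: tau_gt0.
have h20 : 0 < tau_ n.+2 by exact: tau_gt0.
pose h := tau_ n.+1; pose x := t - t_ n.+1.
have x0 : 0 < x by rewrite subr_gt0 (lt_le_trans _ tn)// tmesh_lt.
have tE : t - t_ n = x + h by rewrite /x /h /tau/=; ring.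
have hh : 0 < h by [].
rewrite tE -/x -/h.
apply: (@le_trans _ _ (x `^ (- alpha))); last first.
  rewrite ler_pdivlMr//.
  rewrite (_ : tau_ n.+2 = x - (t - t_ n.+2)); last by rewrite /tau/x/=; ring.
  apply: (@kernel_primitive_ge _ (fun x => x `^ (- alpha))).
  - exact: continuous_pow_primitive.
  - exact: is_derive_pow_primitive.
  - exact: pow_kernel_dec.
  - by rewrite subr_ge0.
  - by rewrite lerD2l lerN2 tmesh_nd.
rewrite ler_pdivrMr//.
have stepP (y z : R) : 0 < y -> y <= z -> P z - P y <= soe w s y * (z - y).
  apply: kernel_primitive_le.
  - exact: continuous_soe_primitive.
  - by move=> u _; exact: is_derive_soe_primitive.
  - by move=> u v _; exact: soe_nonincreasing.
have xh0 : 0 < x + h / 2 by lra.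
have xxh : x <= x + h / 2 by lra.
have xhh : x + h / 2 <= x + h by lra.
have s1 := stepP x (x + h / 2) x0 xxh.
have s2 := stepP (x + h / 2) (x + h) xh0 xhh.
(* The approximation property is available on [[tau 1, T]] only, and is used at [x] and
   [x + h / 2]. *)
have tau1x : tau_ 1 <= x.
  apply: (@le_trans _ _ (tau_ n.+2)); first exact: tau_mono.
  by rewrite /x /tau/= lerD2r.
have tT : t <= T by rewrite (le_trans tn3)// tmesh_le.
have tn0 : 0 <= t_ n by rewrite -(tmesh0 T M r1) tmesh_nd.
have xhT : x + h / 2 <= T.
  have : x + h <= T by rewrite -tE; lra.
  lra.
have e1 : soe w s x <= x `^ (- alpha) + eps.
  have : `|soe w s x - x `^ (- alpha)| <= eps by apply: soew.2; rewrite tau1x/=; lra.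
  by rewrite ler_norml => /andP[_]; lra.
have e2 : soe w s (x + h / 2) <= (x + h / 2) `^ (- alpha) + eps.
  have : `|soe w s (x + h / 2) - (x + h / 2) `^ (- alpha)| <= eps.
    by apply: soew.2; rewrite xhT andbT; lra.
  by rewrite ler_norml => /andP[_]; lra.
(* The grading gives [x <= 2 tau n.+3 <= 4 K (h / 2)], hence [x + h / 2 >= x (1 + 1 / (4 K))]: a
   fixed relative decrease of the power kernel. *)
have gap : 2 * eps <= x `^ (- alpha) - (x + h / 2) `^ (- alpha).
  pose K := r * 3 `^ (r - 1).
  have K0 : 0 < K by rewrite mulr_gt0// powR_gt0.
  have K40 : 0 < 4 * K by rewrite mulr_gt0.
  have x2 : x <= 2 * tau_ n.+3.
    have h1 : x <= tau_ n.+3 + tau_ n.+2 by rewrite /x /tau/=; lra.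
    by have h2 := tauS_le r1 T0 M1 (ltn0Sn n.+1); lra.
  have xK : x * (4 * K)^-1 <= h / 2.
    have ratio := tau_ratio r1 T0 M1 (ltn0Sn n).
    rewrite ler_pdivrMr// (le_trans x2)//.
    by move: ratio; rewrite -/K -/h; lra.
  have xK1 : x * (1 + (4 * K)^-1) <= x + h / 2 by rewrite mulrDr mulr1 lerD2l.
  have K1 : 0 < 1 + (4 * K)^-1 by rewrite addr_gt0// invr_gt0.
  apply: (@le_trans _ _ (x `^ (- alpha) * (1 - (1 + (4 * K)^-1) `^ (- alpha)))); last first.
    rewrite mulrBr mulr1 lerD2l lerN2 -powRM ?(ltW x0) ?(ltW K1)//.
    by apply: pow_kernel_dec => //; rewrite mulr_gt0.
  have q1 : (1 + (4 * K)^-1) `^ (- alpha) <= 1.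
    apply: (@le_trans _ _ (1 `^ (- alpha))); last by rewrite powR1.
    by apply: pow_kernel_dec => //; rewrite lerDl invr_ge0 ltW.
  (* From [x <= 2 r T / M] and [1 / M <= M] comes [x <= 2 r T M], whose power [- alpha] is the
     product in the tolerance. *)
  have xM : (2 * r) `^ (- alpha) * T `^ (- alpha) * M%:R `^ (- alpha) <= x `^ (- alpha).
    rewrite -!powRM ?mulr_ge0 ?(ltW r0) ?(ltW T0)//.
    apply: pow_kernel_dec => //.
    have n3M : (1 <= n.+3 <= M)%N by rewrite nM.
    have hn := tau_le r1 T0 M1 n3M.
    rewrite (le_trans x2)// (@le_trans _ _ (2 * (r * T / M%:R)))// ?ler_pM2l//.
    rewrite -!mulrA !ler_pM2l//.
    rewrite (@le_trans _ _ 1)// ?ler1n// invf_le1 ?ler1n ?ltr0n//.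
  apply: (@le_trans _ _ (2 * (soe_const alpha r * T `^ (- alpha) * M%:R `^ (- alpha)))).
    by rewrite ler_pM2l.
  rewrite (_ : 2 * _ = (2 * r) `^ (- alpha) * T `^ (- alpha) * M%:R `^ (- alpha) *
     (1 - (1 + (4 * K)^-1) `^ (- alpha))); last by rewrite /soe_const -/K; field.
  by rewrite ler_wpM2r// subr_ge0.
rewrite (_ : P (x + h) - P x = (P (x + h) - P (x + h / 2)) + (P (x + h / 2) - P x)); last by ring.
have E1 : x + h / 2 - x = h / 2 by ring.
have E2 : x + h - (x + h / 2) = h / 2 by field.
rewrite E1 in s1; rewrite E2 in s2.
have f1 : soe w s x * (h / 2) <= (x `^ (- alpha) + eps) * (h / 2).
  by rewrite ler_wpM2r// divr_ge0// ltW.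
have f2 : soe w s (x + h / 2) * (h / 2) <= ((x + h / 2) `^ (- alpha) + eps) * (h / 2).
  by rewrite ler_wpM2r// divr_ge0// ltW.
have f3 : 2 * eps * (h / 2) <= (x `^ (- alpha) - (x + h / 2) `^ (- alpha)) * (h / 2).
  by rewrite ler_wpM2r// divr_ge0// ltW.
lra.
Qed.

End fast_coefficients.

Section last_coefficient.
Context {R : realType}.
Variables (alpha r T : R) (M : nat) (N : nat) (w s : 'I_N -> R).
Hypothesis halpha : 0 < alpha < 1.
Hypothesis r1 : 1 <= r.
Hypothesis T0 : 0 < T.
Hypothesis M1 : (1 <= M)%N.

Local Notation t_ := (tmesh r T M).
Local Notation tau_ := (tau r T M).
Local Notation a_ := (fast_coef alpha r T M w s).

(** Replacing the intermediate point by [2 x] is the origin of the factor [2^(1-alpha)] in the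
    smallness condition. *)
Lemma pow_primitive2_diff_le (x y : R) : 0 < x -> 0 < y -> y <= x ->
  pow_primitive2 alpha (x + y) - pow_primitive2 alpha x <=
  pow_primitive alpha (2 * x) * y.
Proof.
move=> x0 y0 yx.
have xy : x < x + y by rewrite ltrDl.
have [| |c] := @MVT R (pow_primitive2 alpha) (pow_primitive alpha) x (x + y) xy.
- move=> z; rewrite in_itv/= => /andP[xz _].
  by apply: is_derive_pow_primitive2 => //; exact: lt_trans xz.
- exact/continuous_subspaceT/continuous_pow_primitive2.
rewrite in_itv/= => /andP[xc cy] ->.
rewrite (_ : x + y - x = y); last by ring.
rewrite ler_wpM2r ?(ltW y0)// pow_primitive_nd//; first by rewrite ltW// (lt_trans x0).
by rewrite (le_trans (ltW cy))// mulr_natl mulr2n lerD2l.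
Qed.

(** Disposes of the default value 0 of a divergent [Gamma (1 - alpha)]; otherwise the integral
    converges and [Gamma_add2_bounds] applies. *)
Lemma fast_coef_Gamma0 n k : Gamma (1 - alpha) = 0 -> a_ n k = 0.
Proof. by rewrite /fast_coef => ->; rewrite mulr0 invr0 mul0r. Qed.

(** Both coefficients are explicit in the second primitive. Cleared of the common prefactor, the
    claim reduces to [main], and multiplying that by [(2 - alpha) (1 - alpha)] produces the constant
    [(2 - alpha) 2^(1-alpha) - 1] of the hypothesis. *)
Lemma fast_coef_last_le n : (n.+2 <= M)%N ->
  ((2 - alpha) * 2 `^ (1 - alpha) - 1) / Gamma (3 - alpha) *
    (r * T / M%:R) `^ (1 - alpha) <= 1 ->
  a_ n.+2 n.+1 / tau_ n.+1 <= (tau_ n.+2)^-1 + a_ n.+2 n.+2 / tau_ n.+2.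
Proof.
move=> nM hyp.
have [a0 a1] := andP halpha.
have h0 : 0 < tau_ n.+1 by exact: tau_gt0.
have h1 : 0 < tau_ n.+2 by exact: tau_gt0.
have [G0|G0] := eqVneq (Gamma (1 - alpha)) 0.
  by rewrite !fast_coef_Gamma0// !mul0r addr0 invr_ge0 ltW.
have be0 : 0 < 1 - alpha by lra.
have be1 : 0 < 2 - alpha by lra.
have Gpos : 0 < Gamma (1 - alpha) by rewrite lt_def G0 Gamma_ge0.
have := Gamma_add2_bounds be0 G0.
rewrite (_ : 1 - alpha + 2 = 3 - alpha); last by ring.
rewrite (_ : 1 - alpha + 1 = 2 - alpha); last by ring.
move=> /andP[G3 G31].
set ta := tau_ n.+2 in h1 *; set x := tau_ n.+1 in h0 *.
have xta : x <= ta by exact: tauS_le.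
have taM : ta <= r * T / M%:R by apply: tau_le => //; rewrite nM.
set Ga := Gamma (1 - alpha) in G0 Gpos G31 *.
have int (a : R) : (@lebesgue_measure R).-integrable `[t_ n.+1, t_ n.+2]
    (EFin \o (fun t => pow_primitive alpha (t - a))).
  apply: continuous_compact_integrable; first exact: segment_compact.
  exact/continuous_subspaceT/continuous_shift/continuous_pow_primitive.
have tt : t_ n.+1 <= t_ n.+2 by exact: tmesh_nd.
have E1 : t_ n.+2 - t_ n = ta + x by rewrite /ta /x /tau/=; ring.
have E2 : t_ n.+1 - t_ n = x by [].
have E3 : t_ n.+2 - t_ n.+1 = ta by [].
have E4 : t_ n.+1 - t_ n.+1 = 0 by exact: subrr.
have I1 := @pow_primitive_integral R alpha halpha (t_ n) _ _
  (tmesh_nd r1 T0 M1 (leqnSn n)) tt.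
have I2 := @pow_primitive_integral R alpha halpha (t_ n.+1) _ _ (lexx _) tt.
rewrite E1 E2 in I1; rewrite E3 E4 (pow_primitive20 halpha) subr0 in I2.
have nearE : a_ n.+2 n.+1 = (ta * Ga)^-1 *
    (pow_primitive2 alpha (ta + x) - pow_primitive2 alpha x - pow_primitive2 alpha ta).
  rewrite -I1 -I2 (fast_coef_near w s halpha r1 T0 M1 n); congr (_ * _).
  by apply: RintegralB => //; exact: int.
have diagE : a_ n.+2 n.+2 = (ta * Ga)^-1 * pow_primitive2 alpha ta.
  by rewrite -I2 (fast_coef_diag r T M w s halpha n.+1).
rewrite nearE diagE; clear nearE diagE E1 E2 E3 E4 I1 I2 int tt.
clearbody ta x Ga.
have W0 : 0 < (ta * Ga)^-1 by rewrite invr_gt0 mulr_gt0.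
apply: (@le_trans _ _ ((ta * Ga)^-1 * pow_primitive alpha (2 * ta))).
  rewrite -mulrA ler_pM2l// ler_pdivrMr//.
  have := pow_primitive2_diff_le h1 h0 xta.
  by have := pow_primitive2_ge0 halpha x; lra.
have main : pow_primitive alpha (2 * ta) <= Ga + pow_primitive2 alpha ta / ta.
  have ta0 := ltW h1.
  have E2 : pow_primitive2 alpha ta / ta =
      ((1 - alpha) * (2 - alpha))^-1 * ta `^ (1 - alpha).
    rewrite /pow_primitive2 pospowE// -mulrA; congr (_ * _).
    rewrite (_ : 2 - alpha = 1 - alpha + 1); last by ring.
    rewrite powRD ?powRr1 ?mulfK ?gt_eqF//.
    by lra.
  rewrite E2 /pow_primitive pospowE ?mulr_ge0// powRM//.
  (* The constant is nonnegative, so the step may be enlarged to [r T / M]; then [Gamma (3 - alpha)]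
     is replaced by its upper bound [G31]. *)
  have h : ((2 - alpha) * 2 `^ (1 - alpha) - 1) * ta `^ (1 - alpha) <=
      (2 - alpha) * (1 - alpha) * Ga.
    apply: le_trans G31; rewrite -[leRHS]mul1r -ler_pdivrMr// mulrAC (le_trans _ hyp)//.
    rewrite ler_wpM2l//; last first.
      by rewrite ge0_ler_powR ?nnegrE ?(ltW be0)// (le_trans ta0).
    rewrite divr_ge0 ?(ltW G3)// subr_ge0 -[leLHS]mulr1.
    apply: ler_pM => //; first by lra.
    apply: (@le_trans _ _ (1 `^ (1 - alpha))); first by rewrite powR1.
    by rewrite ge0_ler_powR ?nnegrE ?(ltW be0)// ler1n.
  rewrite -subr_ge0 -(pmulr_rge0 _ (mulr_gt0 be1 be0)).
  rewrite [X in 0 <= X](_ : _ = (2 - alpha) * (1 - alpha) * Ga -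
    ((2 - alpha) * 2 `^ (1 - alpha) - 1) * ta `^ (1 - alpha)).
    by rewrite subr_ge0.
  by field; rewrite !gt_eqF.
rewrite (_ : ta^-1 + _ = (ta * Ga)^-1 * (Ga + pow_primitive2 alpha ta / ta)).
  by rewrite ler_pM2l.
by field; rewrite !gt_eqF.
Qed.

End last_coefficient.

(** * Stability *)

Lemma soe_const_gt0 (R : realType) (alpha r : R) : 0 < alpha -> 1 <= r ->
  0 < soe_const alpha r.
Proof.
move=> a0 r1; have r0 : 0 < r by exact: lt_le_trans r1.
have K0 : 0 < (4 * (r * 3 `^ (r - 1)))^-1 by rewrite invr_gt0 !mulr_gt0// powR_gt0.
rewrite /soe_const divr_gt0// mulr_gt0 ?powR_gt0 ?mulr_gt0//.
set K := (_)^-1 in K0 *.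
rewrite subr_gt0 powRN invf_lt1 ?powR_gt0 ?addr_gt0//.
apply: (@le_lt_trans _ _ (1 `^ alpha)); first by rewrite powR1.
by rewrite gt0_ltr_powR ?nnegrE ?addr_ge0 ?(ltW K0)// ltrDl.
Qed.

Lemma tau_le_max (R : realType) (r T : R) (M n : nat) : (1 <= n <= M)%N ->
  tau r T M n <= tau_max r T M.
Proof.
move=> /andP[n1 nM]; rewrite /tau_max; apply: le_bigmax_seq => //.
by rewrite mem_index_iota n1 ltnS.
Qed.

Section weak_formulation.
Context {R : realType} {d : nat}.
Variables (alpha r T : R) (M N : nat) (w s : 'I_N -> R).
Variable Omega : set 'rV[R]_d.
Variable v : nat -> 'rV[R]_d -> R.

Local Notation t_ := (tmesh r T M).
Local Notation tau_ := (tau r T M).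
Local Notation a_ := (fast_coef alpha r T M w s).

(** The diagonal coefficient joins [1 / tau] in front of the newest increment and forms the [B] of
    [scalar_step]; the other increments are the history. *)
Lemma L2inner_scheme (z : 'rV[R]_d -> R) n :
  (forall k, L2 Omega (v k)) -> L2 Omega z ->
  L2inner Omega (diff_quot r T M v n.+1 \+ fast_L1 alpha r T M w s v n.+1) z =
  ((tau_ n.+1)^-1 + a_ n.+1 n.+1 / tau_ n.+1) *
    (L2inner Omega (v n.+1) z - L2inner Omega (v n) z) +
  \sum_(1 <= k < n.+1) a_ n.+1 k / tau_ k *
    (L2inner Omega (v k) z - L2inner Omega (v k.-1) z).
Proof.
move=> Lv Lz; pose vd k : 'rV[R]_d -> R := fun x => -1 * v k.-1 x + v k x.
have Lvd k : L2 Omega (vd k) by exact: L2_lin.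
pose b k := a_ n.+1 k / tau_ k.
rewrite (_ : _ \+ _ = fun x => (tau_ n.+1)^-1 * vd n.+1 x +
    \sum_(k <- index_iota 1 n.+2) b k * vd k x); last first.
  apply/funext => x /=; congr (_ + _); first by rewrite /diff_quot /vd/=; ring.
  by apply: eq_bigr => k _; rewrite /diff_quot /vd /b; ring.
rewrite L2inner_linl//; last exact: L2_sum.
rewrite L2inner_suml//.
have E k : L2inner Omega (vd k) z =
    L2inner Omega (v k) z - L2inner Omega (v k.-1) z.
  by rewrite L2inner_linl// mulN1r addrC.
under eq_bigr do rewrite E.
by rewrite E big_nat_recr//= /b; ring.
Qed.

Lemma weak_gradient_midpoint (g : nat -> 'I_d -> 'rV[R]_d -> R) n :
  (forall k, L2 Omega (v k)) -> (forall k, weak_gradient Omega (v k) (g k)) ->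
  weak_gradient Omega (midpoint v n)
    (fun i x => 2^-1 * g n i x + 2^-1 * g n.-1 i x).
Proof.
move=> Lv gv.
have H : weak_gradient Omega (fun x => 2^-1 * v n.-1 x + 0)
    (fun i x => 2^-1 * g n.-1 i x + 0).
  by apply: (weak_gradient_lin _ (Lv _) (@L2_0 _ _ _) (gv _) (@weak_gradient_0 _ _ _)).
have LH : L2 Omega (fun x => 2^-1 * v n.-1 x + 0) by apply: L2_lin => //; exact: L2_0.
have := weak_gradient_lin 2^-1 (Lv n) LH (gv n) H.
rewrite (_ : (fun x => _) = midpoint v n); last first.
  by apply/funext => x; rewrite /midpoint; lra.
rewrite (_ : (fun i x => _) = (fun i x => 2^-1 * g n i x + 2^-1 * g n.-1 i x))//.
by apply/funext => i; apply/funext => x; rewrite addr0.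
Qed.

Lemma L2inner_midpoint (z : 'rV[R]_d -> R) n :
  (forall k, L2 Omega (v k)) -> L2 Omega z ->
  L2inner Omega (midpoint v n) z =
  (L2inner Omega (v n) z + L2inner Omega (v n.-1) z) / 2.
Proof.
move=> Lv Lz.
have L0 : L2 Omega (fun=> 0) by exact: L2_0.
rewrite (_ : midpoint v n = fun x => 2^-1 * v n x + (2^-1 * v n.-1 x + 0)).
  by rewrite !L2inner_linl// ?L2inner_0l; [lra|exact: L2_lin].
by apply/funext => x; rewrite /midpoint; lra.
Qed.

End weak_formulation.

Section mode_equation.
Context {R : realType}.

(* The pencil eigenvalue [th] is the inverse of the Dirichlet eigenvalue; a
   vanishing [th] belongs to a mode that is null in L^2. *)
Lemma mode_equation (b : nat -> R) (y : nat -> R) (B th mu F : R) n :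
  0 <= th ->
  B * (th * y n.+1 - th * y n) +
    \sum_(1 <= k < n.+1) b k * (th * y k - th * y k.-1) =
    - (2^-1 * y n.+1 + 2^-1 * y n) +
    mu * ((th * y n.+1 + th * y n) / 2) + F ->
  let x k := Num.sqrt th * y k in
  B * (x n.+1 - x n) + \sum_(1 <= k < n.+1) b k * (x k - x k.-1) =
    - (if th == 0 then 0 else th^-1 - mu) * ((x n.+1 + x n) / 2) +
    F / Num.sqrt th.
Proof.
move=> th0 eqy x; have [thE|thN] := eqVneq th 0.
  have x0 k : x k = 0 by rewrite /x thE sqrtr0 mul0r.
  rewrite !x0 thE sqrtr0 invr0 !mulr0 subrr mulr0 big1 ?addr0 ?mul0r ?mulr0//.
  by move=> k _; rewrite !x0 subrr mulr0.
have thP : 0 < th by rewrite lt_def thN.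
set q := Num.sqrt th; have q0 : 0 < q by rewrite sqrtr_gt0.
have qq : th = q * q by rewrite -expr2 sqr_sqrtr.
pose L := B * (y n.+1 - y n) + \sum_(1 <= k < n.+1) b k * (y k - y k.-1).
have EL (c : R) : B * (c * y n.+1 - c * y n) +
    \sum_(1 <= k < n.+1) b k * (c * y k - c * y k.-1) = c * L.
  rewrite /L [RHS]mulrDr mulr_sumr; congr (_ + _); first by ring.
  by apply: eq_bigr => k _; ring.
rewrite EL in eqy; rewrite EL.
apply: (mulfI (lt0r_neq0 q0)); rewrite mulrA -qq eqy -/q qq /x -/q.
by field; rewrite gt_eqF.
Qed.

End mode_equation.

Lemma fast_weights (R : realType) (alpha r T : R) (M N : nat)
    (w s : 'I_N -> R) (eps : R) (m : nat) (b := fun k =>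
      fast_coef alpha r T M w s m.+1 k / tau r T M k)
    (B := (tau r T M m.+1)^-1 + fast_coef alpha r T M w s m.+1 m.+1 / tau r T M m.+1) :
  0 < alpha < 1 -> 1 <= r -> 0 < T -> (1 <= M)%N ->
  soe_approx alpha r T M w s eps ->
  eps <= soe_const alpha r * T `^ (- alpha) * M%:R `^ (- alpha) ->
  ((2 - alpha) * 2 `^ (1 - alpha) - 1) / Gamma (3 - alpha) *
    (r * T / M%:R) `^ (1 - alpha) <= 1 ->
  (m < M)%N ->
  [/\ b 0%N = 0, forall k, (k < m)%N -> b k <= b k.+1, b m <= B &
      (tau r T M m.+1)^-1 <= B].
Proof.
move=> ha r1 T0 M1 soew heps hyp mM.
have t0 k : (1 <= k)%N -> 0 < tau r T M k by exact: tau_gt0.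
(* As [0.-1] is 0, [tau 0] vanishes, and division by it yields the convention of [abel_bound]. *)
have b0 : b 0%N = 0 by rewrite /b /tau/= subrr invr0 mulr0.
have bge0 k : 0 <= b k.
  case: k => [|k]; first by rewrite b0.
  rewrite /b; apply: divr_ge0; last by apply: ltW; exact: t0.
  exact: (fast_coef_ge0 r1 T0 M1 soew).
have tB : (tau r T M m.+1)^-1 <= B by rewrite /B lerDl; exact: (bge0 m.+1).
split=> //.
- move=> [_|k km]; first by rewrite b0.
  have [k2m|mk2] := leqP k.+3 m.
    exact: (fast_coef_far_mono r1 T0 M1 soew).
  have mE : m = k.+2 by apply/eqP; rewrite eqn_leq km -ltnS mk2.
  rewrite /b; clear -ha r1 T0 M1 soew heps mM mE; subst m.
  exact: (fast_coef_last_mono ha r1 T0 M1 soew mM heps).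
- case: m mM @b @B b0 bge0 tB => [|m] mM b B b0 bge0 tB.
    by rewrite b0; apply: le_trans tB; rewrite invr_ge0 ltW// t0.
  exact: (fast_coef_last_le w s ha r1 T0 M1 mM hyp).
Qed.

(** At [rho = 0] the exponential and the factor [rho1 / (rho1 - rho)] are 1, so a single bound
    yields both cases of the theorem. *)
Theorem weak_solution_stability (R : realType) (alpha r T : R) (M : nat) (eps : R)
    (N : nat) (w s : 'I_N -> R) (d : nat) (Omega : set 'rV[R]_d) (CP mu rho : R)
    (f : 'rV[R]_d -> R -> R) (phi : 'rV[R]_d -> R) (v : nat -> 'rV[R]_d -> R)
    (rho1 := 2 / tau_max r T M) :
  0 < alpha < 1 -> 1 <= r -> 0 < T -> (1 <= M)%N ->
  soe_approx alpha r T M w s eps ->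
  eps <= soe_const alpha r * T `^ (- alpha) * M%:R `^ (- alpha) ->
  ((2 - alpha) * 2 `^ (1 - alpha) - 1) / Gamma (3 - alpha) *
    (r * T / M%:R) `^ (1 - alpha) <= 1 ->
  poincare Omega CP -> 0 <= rho < rho1 -> mu - CP ^- 2 <= rho ->
  (forall n, (1 <= n <= M)%N -> L2 Omega (time_avg r T M f n)) ->
  weak_solution alpha r T M w s Omega mu f phi v ->
  forall n, (n <= M)%N -> L2norm Omega (v n) <=
    expR (rho * rho1 / (rho1 - rho) * tmesh r T M n) *
    (L2norm Omega (v 0%N) + rho1 / (rho1 - rho) *
      \sum_(1 <= j < n.+1) tau r T M j * L2norm Omega (time_avg r T M f j)).
Proof.
move=> ha r1 T0 M1 soew heps hyp poinc /andP[rho0 rhor1] murho Lf [_ Hv eqv].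
(* Nothing is known of [v] beyond [M]; freezing the index puts every [u k] in [H01]. *)
pose u k := v (minn k M).
have uE k : (k <= M)%N -> u k = v k by move=> kM; rewrite /u (minn_idPl kM).
have Hu k : H01 Omega (u k) by apply: Hv; exact: geq_minr.
have Lu k : L2 Omega (u k) := (Hu k).1.
have [g gu] : exists g, forall k, weak_gradient Omega (u k) (g k).
  have /choice[g gu] : forall k, exists g, weak_gradient Omega (u k) g.
    by move=> k; have [_ [g gk _]] := Hu k; exists g.
  by exists g.
have [e [ge [th [He thb ue uu ee]]]] := H01_modes (v := fun k : 'I_M.+1 => u k)
  (g := fun k : 'I_M.+1 => g k) (fun k => Hu k) (fun k => gu k) poinc (ltn0Sn M).
have Le i : L2 Omega (e i) := (He i).1.1.
pose F n := L2norm Omega (time_avg r T M f n).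
pose y i k := L2vinner Omega (g k) (ge i).
(* The factor [sqrt (th i)] makes the Euclidean norm of the coordinates equal to the L^2 norm of the
   solution; dividing the source by it matches the sum in Bessel's inequality. *)
pose x i k := Num.sqrt (th i) * y i k.
pose ph i n := L2inner Omega (time_avg r T M f n) (e i) / Num.sqrt (th i).
have th0 i : 0 <= th i by have /andP[] := thb i.
have ueE k i : (k <= M)%N -> L2inner Omega (u k) (e i) = th i * y i k.
  by move=> kM; have := ue (inord k) i; rewrite inordK.
have xu k : (k <= M)%N -> l2norm (x^~ k) = L2norm Omega (u k).
  move=> kM; apply/eqP; rewrite -(@eqrXn2 _ 2) ?l2norm_ge0 ?L2norm_ge0//.
  rewrite l2norm_sqr; have := uu (inord k); rewrite inordK// => ->.
  by apply/eqP/eq_bigr => i _; rewrite exprMn sqr_sqrtr.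
have phF n : (n < M)%N -> l2norm (ph^~ n.+1) <= F n.+1.
  move=> nM; rewrite -(@ler_pXn2r _ 2) ?nnegrE ?l2norm_ge0 ?L2norm_ge0//.
  rewrite l2norm_sqr; apply: le_trans (ee _ (Lf n.+1 nM)).
  by apply: ler_sum => i _; rewrite exprMn exprVn sqr_sqrtr.
have tp k : (1 <= k)%N -> 0 < tau r T M k by exact: tau_gt0.
have tm0 : 0 < tau_max r T M.
  by apply: lt_le_trans (tau_le_max r T (n := 1) (M := M) _); [exact: tp|rewrite M1].
have rho10 : 0 < rho1 by rewrite divr_gt0.
have rt k : (1 <= k <= M)%N -> rho1 * tau r T M k <= 2.
  move=> kM; rewrite /rho1 mulrAC ler_pdivrMr// ler_pM2l//.
  exact: tau_le_max.
have rt2 k : (1 <= k <= M)%N -> rho * tau r T M k < 2.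
  move=> kM; apply: lt_le_trans (rt k kM).
  by rewrite ltr_pM2r//; apply: tp; case/andP: kM.
(* Extension by 0 gives [q] and [p] their sign conditions at every index, as [amplitude_bound]
   asks. *)
pose ta k := if (1 <= k <= M)%N then tau r T M k else 0.
have ta0 k : 0 <= ta k.
  by rewrite /ta; case: ifP => // /andP[k1 _]; rewrite ltW// tp.
have den k : 0 < 1 - rho * ta k / 2.
  by rewrite /ta; case: ifP => kM; [have := rt2 k kM; lra|lra].
have taE k : (k < M)%N -> ta k.+1 = tau r T M k.+1 by rewrite /ta => ->.
have rr0 : 0 < rho1 - rho by rewrite subr_gt0.
have c0 : 0 <= rho1 / (rho1 - rho) by apply: divr_ge0; exact: ltW.
(* [rho1 tau <= 2] gives [1 - rho tau / 2 >= 1 - rho / rho1], a bound uniform in the step. *)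
have denc k : (k < M)%N -> (1 - rho * ta k.+1 / 2)^-1 <= rho1 / (rho1 - rho).
  move=> kM; rewrite ler_pdivlMr// mulrC ler_pdivrMr//.
  have := rt k.+1 kM; rewrite -taE// => h.
  have : rho * (rho1 * ta k.+1) <= rho * 2 by rewrite ler_wpM2l.
  clearbody rho1; clear -h; lra.
pose q k := (1 + rho * ta k / 2) / (1 - rho * ta k / 2).
pose p k := ta k / (1 - rho * ta k / 2).
have q1 k : 1 <= q k.
  rewrite /q ler_pdivlMr// mul1r; have : 0 <= rho * ta k by rewrite mulr_ge0.
  lra.
have p0 k : 0 <= p k by rewrite /p divr_ge0// ltW.
have stepx n i Y : (n < M)%N -> (forall k, (k <= n)%N -> `|x i k| <= Y) ->
    `|x i n.+1| <= q n.+1 * Y + p n.+1 * `|ph i n.+1|.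
  move=> nM xY.
  have [b0 bS bB tB] := fast_weights ha r1 T0 M1 soew heps hyp nM.
  rewrite /q /p taE//.
  apply: (scalar_step (lam := if th i == 0 then 0 else (th i)^-1 - mu)
    b0 bS bB _ tB _ rho0 _ xY); [exact: tp| |exact: rt2| ].
    (* Here [th i <= CP^2] gives [lam >= CP^-2 - mu >= - rho]; a null mode has [lam = 0]. *)
    have [_|thN] /= := eqVneq (th i) 0; first by rewrite oppr_le0.
    have thP : 0 < th i by rewrite lt_def thN th0.
    rewrite -opprB lerN2 (le_trans _ murho)// lerD2l lerN2.
    by rewrite lef_pV2 ?posrE//; [case/andP: (thb i)|rewrite exprn_gt0// poinc.1].
  apply: mode_equation => //.
  have vu k : (k <= n.+1)%N -> v k = u k.
    by move=> kn; rewrite uE// (leq_trans kn).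
  have := eqv n.+1 nM (e i) (ge i) _ (He i).1 (He i).2.
  have -> : midpoint v n.+1 = midpoint u n.+1 by rewrite /midpoint !vu.
  have -> : diff_quot r T M v n.+1 \+ fast_L1 alpha r T M w s v n.+1 =
      diff_quot r T M u n.+1 \+ fast_L1 alpha r T M w s u n.+1.
    apply/funext => z /=; rewrite /diff_quot /fast_L1 !vu//; congr (_ + _).
    apply: eq_big_nat => k /andP[_ kn].
    by rewrite /diff_quot !vu// (leq_trans (leq_pred _)).
  move/(_ _ (weak_gradient_midpoint n.+1 Lu gu)).
  rewrite L2inner_scheme// L2inner_midpoint// L2vinner_lin2//; last first.
  - by move=> j; exact: (He i).2.1.
  - by move=> j; exact: (gu _).1.
  - by move=> j; exact: (gu _).1.
  rewrite !ueE//; [|exact: ltnW..].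
  rewrite /y /= => <-; congr (_ + _).
  apply: eq_big_nat => k /andP[_ kn].
  have kM : (k <= M)%N by rewrite (leq_trans _ nM)// ltnW.
  by rewrite !ueE// (leq_trans (leq_pred _)).
have [W [W0 WS xW]] := amplitude_bound q1 p0 stepx phF.
move=> n nM; rewrite -(uE n nM) -(xu n nM) (le_trans (xW n nM))//.
rewrite -(uE 0%N isT) -(xu 0%N isT) -W0.
apply: (discrete_gronwall (q := q) (p := p) (F := F) (M := M)) => //.
- by rewrite -mulrA; apply: mulr_ge0.
- by rewrite W0 l2norm_ge0.
- exact: tmesh0.
- by move=> k _; exact: tmesh_nd.
- by move=> k; exact: L2norm_ge0.
- move=> k kM; rewrite (le_trans ler01 (q1 k.+1))/=.
  (* From [(1 + z) / (1 - z) = 1 + 2 z / (1 - z)] with [z = rho tau / 2]; with [denc], this is the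
     growth rate [rho rho1 / (rho1 - rho)]. *)
  have -> : q k.+1 = 1 + rho * ta k.+1 * (1 - rho * ta k.+1 / 2)^-1.
    have D0 := lt0r_neq0 (den k.+1).
    by apply: (mulIf D0); rewrite /q divfK// mulrDl mul1r divfK//; field.
  rewrite lerD2l -[tmesh _ _ _ k.+1 - _]/(tau r T M k.+1) -[tau _ _ _ _](taE _ kM).
  rewrite -[rho * rho1 / _]mulrA -[leRHS]mulrA (mulrC (rho1 / _)) [leRHS]mulrA.
  by rewrite ler_wpM2l ?mulr_ge0// denc.
- move=> k kM; rewrite -[tmesh _ _ _ k.+1 - _]/(tau r T M k.+1) -[tau _ _ _ _](taE _ kM).
  by rewrite /p mulrC ler_wpM2r// denc.
Qed.

Theorem theorem3p1 (R : realType) (alpha r : R)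
    (halpha : 0 < alpha < 1) (hr : 1 <= r) :
  exists2 c : R, 0 < c &
  forall (T : R) (M : nat) (eps : R)
    (Nexp : nat) (varpi s : 'I_Nexp -> R)
    (d : nat) (Omega : set 'rV[R]_d) (CP lam : R)
    (f : 'rV[R]_d -> R -> R) (phi : 'rV[R]_d -> R)
    (v : nat -> 'rV[R]_d -> R),
  let mu := lam - d%:R / 4 in
  let rho1 := 2 / tau_max r T M in
  let rho := Num.max (mu - CP ^- 2) 0 in
  0 < T -> (1 <= M)%N -> 0 < eps ->
  soe_approx alpha r T M varpi s eps ->
  (d = 1%N \/ d = 2%N) -> is_domain Omega -> poincare Omega CP -> 0 < lam ->
  admissible_source r T M Omega f ->
  eps <= c * T `^ (- alpha) * M%:R `^ (- alpha) ->
  ((2 - alpha) * 2 `^ (1 - alpha) - 1) / Gamma (3 - alpha) *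
    (r * T / M%:R) `^ (1 - alpha) <= 1 ->
  0 <= rho < rho1 ->
  weak_solution alpha r T M varpi s Omega mu f phi v ->
  forall n, (1 <= n <= M)%N ->
    (0 < rho ->
      L2norm Omega (v n) <=
      expR (rho * rho1 * tmesh r T M n / (rho1 - rho)) *
      (L2norm Omega (v 0%N) +
       rho1 / (rho1 - rho) *
       \sum_(1 <= j < n.+1) tau r T M j * L2norm Omega (time_avg r T M f j)))
    /\
    (rho = 0 ->
      L2norm Omega (v n) <=
      L2norm Omega (v 0%N) +
      \sum_(1 <= j < n.+1) tau r T M j * L2norm Omega (time_avg r T M f j)).
Proof.
exists (soe_const alpha r); first by apply: soe_const_gt0 => //; case/andP: halpha.
move=> T M eps Nexp varpi s d Omega CP lam f phi v mu rho1 rho T0 M1 eps0 soew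
  _ _ poinc _ [_ Lf] heps hyp hrho sol n /andP[n1 nM].
have murho : mu - CP ^- 2 <= rho by rewrite /rho le_max lexx.
have H := weak_solution_stability halpha hr T0 M1 soew heps hyp poinc hrho murho
  Lf sol nM.
split=> [_|rhoE].
  by rewrite [rho * rho1 * _ / _]mulrAC.
have rho10 : rho1 != 0 by rewrite gt_eqF//; move: hrho; rewrite rhoE lexx.
by move: H; rewrite rhoE subr0 divff// !mul0r expR0 !mul1r.
Qed.
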